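(* Let $1\le p<2$ and let $(X_n)_{n\ge1}$ be a determining sequence of random variables on a probability space $(\Omega,\mathcal F,P)$ such that $\|X_n\|_p=1$ for all $n$, the family $\{|X_n|^p:n\ge1\}$ is uniformly integrable, and $X_n\to0$ weakly in $L^p$ (i.e. $\mathbb E(X_nZ)\to0$ for every $Z\in L^q$, $1/p+1/q=1$). Let $\mu$ be the limit random measure of $(X_n)$. Then there exists a subsequence $(X_{n_k})$ equivalent (in $L^p$) to the unit vector basis of $\ell^2$ if and only if $$\int_{-\infty}^{\infty}x^2\,d\mu(x)\in L^{p/2}(\Omega,\mathcal F,P),$$ i.e. $\mathbb E\big(\int x^2\,d\mu(x)\big)^{p/2}<\infty$.
   Context: A sequence $(X_n)$ of random variables is called determining if for every $A\in\mathcal F$ with $P(A)>0$ there is a distribution function $F_A$ with $P(X_n\le t\mid A)\to F_A(t)$ at every continuity point $t$ of $F_A$. For a determining sequence there exists a random measure $\mu$ (a measurable map from $(\Omega,\mathcal F)$ into the space of Borel probability measures on $\mathbb R$ equipped with the Prohorov metric) such that for every $A$ with $P(A)>0$ and every continuity point $t$ of $F_A$, $F_A(t)=\mathbb E_A\big(\mu(-\infty,t]\big)$, where $\mathbb E_A$ denotes conditional expectation given $A$, i.e. $\mathbb E_A(Z)=P(A)^{-1}\int_A Z\,dP$; $\mu$ is called the limit random measure of $(X_n)$. Two sequences $(x_n),(y_n)$ in a Banach space are equivalent if there is $K>0$ with $K^{-1}\|\sum_{i=1}^n a_ix_i\|\le\|\sum_{i=1}^n a_iy_i\|\le K\|\sum_{i=1}^n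 a_ix_i\|$ for all $n\ge1$ and all $(a_1,\dots,a_n)\in\mathbb R^n$. Equivalence of $(X_{n_k})$ to the unit vector basis of $\ell^2$ means there is $K>0$ with $K^{-1}(\sum a_i^2)^{1/2}\le\|\sum_{i=1}^n a_iX_{n_i}\|_p\le K(\sum a_i^2)^{1/2}$ for all $n$ and $a\in\mathbb R^n$. *)

(* Defs.v *)
From HB Require Import structures.
From mathcomp Require Import all_boot all_order all_algebra.
From mathcomp Require Import all_classical all_reals all_analysis.
Set Implicit Arguments.
Unset Strict Implicit.
Unset Printing Implicit Defensive.
Import Order.TTheory GRing.Theory Num.Theory.
Import numFieldNormedType.Exports.
Local Open Scope classical_set_scope.
Local Open Scope ring_scope.

Definition distribution_function (R : realType) (F : R -> R) : Prop :=
  [/\ {homo F : x y / x <= y},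
      (forall t : R, F x @[x --> t^'+] --> F t),
      F x @[x --> -oo] --> (0:R) &
      F x @[x --> +oo] --> (1:R)].

Definition cond_prob d (T : measurableType d) (R : realType)
  (P : probability T R) (A B : set T) : R :=
  fine (P (B `&` A)) / fine (P A).

Definition cond_expect d (T : measurableType d) (R : realType)
  (P : probability T R) (A : set T) (Z : T -> \bar R) : R :=
  fine (\int[P]_(w in A) Z w) / fine (P A).

Definition determining d (T : measurableType d) (R : realType)
  (P : probability T R) (X : nat -> T -> R) : Prop :=
  forall A : set T, measurable A -> (0 < P A)%E ->
    exists F : R -> R, distribution_function F /\
      forall t : R, {for t, continuous F} ->
        (fun n => cond_prob P A [set w | X n w <= t]) @ \oo --> F t.

Definition limit_random_measure d (T : measurableType d) (R : realType)
  (P : probability T R) (X : nat -> T -> R) (mu : R.-pker T ~> R) : Prop :=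
  forall A : set T, measurable A -> (0 < P A)%E ->
    forall F : R -> R, distribution_function F ->
      (forall t : R, {for t, continuous F} ->
        (fun n => cond_prob P A [set w | X n w <= t]) @ \oo --> F t) ->
      forall t : R, {for t, continuous F} ->
        F t = cond_expect P A (fun w => mu w [set` `]-oo, t]]).

Definition uniformly_integrable d (T : measurableType d) (R : realType)
  (P : probability T R) (f : nat -> T -> R) : Prop :=
  forall e : R, 0 < e -> exists c : R, forall n,
    (\int[P]_(w in [set w | (c < `|f n w|)%R]) (`|f n w|)%:E <= e%:E)%E.

Definition conj_exp (R : realType) (p : R) : \bar R :=
  if p == 1 then +oo%E else (p / (p - 1))%:E.

Definition weakly_to_zero d (T : measurableType d) (R : realType)
  (P : probability T R) (p : R) (X : nat -> T -> R) : Prop :=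
  forall Z : T -> R, measurable_fun setT Z ->
    (Lnorm P (conj_exp p) (EFin \o Z) < +oo)%E ->
    (fun n => (\int[P]_w (X n w * Z w)%:E)%E) @ \oo --> 0%E.

Definition has_l2_subsequence d (T : measurableType d) (R : realType)
  (P : probability T R) (p : R) (X : nat -> T -> R) : Prop :=
  exists nk : nat -> nat, (forall k, (nk k < nk k.+1)%N) /\
  exists K : R, 0 < K /\
    forall (m : nat) (a : 'I_m -> R),
      ((K^-1 * Num.sqrt (\sum_(i < m) a i ^+ 2))%:E <=
         Lnorm P p%:E (fun w => (\sum_(i < m) a i * X (nk i) w)%:E))%E /\
      (Lnorm P p%:E (fun w => (\sum_(i < m) a i * X (nk i) w)%:E) <=
         (K * Num.sqrt (\sum_(i < m) a i ^+ 2))%:E)%E.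

(* Main.v *)
Require Import Defs.
From HB Require Import structures.
From mathcomp Require Import all_boot all_order all_algebra.
From mathcomp Require Import all_classical all_reals all_analysis.
From mathcomp Require Import measurable_realfun ess_sup_inf ring lra.
Set Implicit Arguments.
Unset Strict Implicit.
Unset Printing Implicit Defensive.
Import Order.TTheory GRing.Theory Num.Theory.
Import numFieldNormedType.Exports.
Local Open Scope classical_set_scope.
Local Open Scope ring_scope.

(** For [A] with [P A > 0], the cdf of [X n] given [A] converges at the continuity
    points of [F_A]; approximating a Lipschitz function that is constant near both
    infinities by step functions with jumps at such points upgrades this to stable
    convergence: [E (g (X n) W) --> E (gbar W)] for integrable [W], where
    [gbar w] is the integral of [g] against [mu w].

    Necessity: averaging the upper [l2] estimate over signs gives, by Khintchine,
    [E ((sum_(j < N) X_j ^ 2 / N) ^ (p / 2)) <= 4 K ^ p] along every further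
    subsequence.  For the truncations [g] of [x ^ 2], a further subsequence makes
    the variables [g (X_j) - gbar] almost orthogonal, so their averages are bounded
    in [L2] and [E (gbar ^ (p / 2))] is bounded uniformly in the truncation level.

    Sufficiency, upper bound: with [t = sqrt (1 + \int x^2 dmu)] one has
    [|s| ^ p <= s ^ 2 t ^ (p - 2) + t ^ p], and [t ^ p] is integrable.  Under the
    weight [t ^ (p - 2)] the suitably truncated [X n] have bounded second moments and
    a sparse subsequence is almost orthogonal.

    Sufficiency, lower bound: test [S = sum_j a_j X_j] against the imaginary part of
    the Riesz product [prod_j (1 + i a_j Z_j)], with [Z_j] the truncation of [X_j] at a
    fixed level minus its conditional mean.  Since [sum_j a_j ^ 2 = 1] the product is
    bounded, and along a sparse subsequence [E (S . Im prod)] is close to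
    [sum_j a_j ^ 2 v] for a positive limiting covariance [v]. *)

(** * Selection of subsequences and elementary inequalities *)

Section SequentialSelection.

(** Dependent choice in which the condition on the new term sees the list of all earlier terms;
    every sparse subsequence below comes from it, with [size s] as the index of the new term. *)
Lemma sequential_choice (U : Type) (Q : seq U -> U -> Prop) :
  (forall s, exists x, Q s x) ->
  exists f : nat -> U, forall i, Q (mkseq f i) (f i).
Proof.
move=> /choice[c cQ].
pose g := fix g n := if n is m.+1 then rcons (g m) (c (g m)) else [::].
exists (fun i => c (g i)) => i; suff -> : mkseq (fun i => c (g i)) i = g i by [].
by elim: i => //= i IH; rewrite mkseqS IH.
Qed.

Lemma near_in_seq (U : eqType) (s : seq U) (Q : U -> nat -> Prop) :
  (forall x, x \in s -> \forall n \near \oo, Q x n) ->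
  \forall n \near \oo, forall x, x \in s -> Q x n.
Proof.
elim: s => [|y s IH] H; first by near=> n.
have H1 := H y (mem_head _ _).
have {}IH : \forall n \near \oo, forall x, x \in s -> Q x n.
  by apply: IH => x xs; apply: H; rewrite inE xs orbT.
near=> n => x; rewrite inE => /predU1P[->|]; first by near: n.
by move: x; near: n.
Unshelve. all: by end_near. Qed.

End SequentialSelection.

(** * Elementary inequalities for real powers *)

Section RealInequalities.
Context (R : realType).
Implicit Types (x y c s t h p M : R).

Lemma le_dist_third (e a b a' b' : R) : `|a - b| <= e / 3 ->
  `|a' - b'| <= e / 3 -> `|b' - b| <= e / 3 -> `|a' - a| <= e.
Proof.
rewrite !ler_norml => /andP[? ?] /andP[? ?] /andP[? ?].
by apply/andP; split; lra.
Qed.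

Lemma powR_add_le4 p x y : 1 <= p -> p <= 2 ->
  `|x + y| `^ p <= 4 * (`|x| `^ p + `|y| `^ p).
Proof.
move=> p1 p2; have p0 : 0 <= p by lra.
wlog xy : x y / `|x| <= `|y|.
  move=> H; have [xy|/ltW yx] := leP `|x| `|y|; first exact: H.
  by rewrite addrC (addrC (_ `^ _)); exact: H.
have h1 : `|x + y| <= 2 * `|y| by apply: (le_trans (ler_normD _ _)); lra.
apply: (@le_trans _ _ ((2 * `|y|) `^ p)).
  by apply: ge0_ler_powR => //; rewrite nnegrE ?mulr_ge0.
rewrite powRM//.
have : (2:R) `^ p <= 4.
  have -> : 4 = (2:R) `^ 2%:R by rewrite powR_mulrn//; ring.
  by apply: ler_powR => //; lra.
have := powR_ge0 `|x| p; have := powR_ge0 `|y| p; nra.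
Qed.

(** Each use of the two-term bound costs a factor 4. The growing weights are affordable because the
    truncation errors they will multiply are at most [(8^-1) ^+ i.+1]. *)
Lemma powR_sum_le4 p (u : nat -> R) n : 1 <= p -> p <= 2 ->
  `|\sum_(i < n) u i| `^ p <= \sum_(i < n) 4 ^+ i.+1 * `|u i| `^ p.
Proof.
move=> p1 p2; have p0 : 0 < p by exact: lt_le_trans ltr01 p1.
elim: n u => [|n IH] u.
  by rewrite !big_ord0 normr0 powR0// gt_eqF.
rewrite !big_ord_recl/= expr1; apply: (le_trans (powR_add_le4 _ _ p1 p2)).
rewrite mulrDr lerD2l.
apply: (@le_trans _ _ (4 * \sum_(i < n) 4 ^+ i.+1 * `|u i.+1| `^ p)).
  by rewrite ler_pM2l//; exact: (IH (fun i => u i.+1)).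
rewrite mulr_sumr; apply: ler_sum => i _.
by rewrite mulrA -exprS.
Qed.

(** For [|x| <= 1] the power is at most [|x|], and [|x| <= 1 / 4 + x ^ 2] because
    [(|x| - 1 / 2) ^ 2 >= 0]. *)
Lemma powR_le_quarter_sqr p x : 1 <= p -> p <= 2 -> `|x| `^ p <= 1 / 4 + x ^+ 2.
Proof.
move=> p1 p2; have p0 : 0 < p by exact: lt_le_trans ltr01 p1.
rewrite -real_normK ?num_real//.
set y := `|x|; have y0 : 0 <= y by exact: normr_ge0.
have [y1|y1] := leP 1 y.
  apply: (@le_trans _ _ (y ^+ 2)); last lra.
  by rewrite -powR_mulrn//; apply: ler_powR.
have [->|yn0] := eqVneq y 0; first by rewrite powR0 ?gt_eqF// addr_ge0 ?sqr_ge0 ?divr_ge0.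
apply: (@le_trans _ _ y); last by have := sqr_ge0 (y - 1 / 2); nra.
have : 0 < y <= 1 by rewrite lt_neqAle eq_sym yn0 y0 ltW.
by move=> y01; apply: (ge1r_powR y01).
Qed.

(** An affine minorant of the power above the threshold [h]; it turns a lower bound on the first
    absolute moment into one on the [p]-th moment. *)
Lemma norm_le_powR p h x : 1 <= p -> 0 < h ->
  h `^ (p - 1) * (`|x| - h) <= `|x| `^ p.
Proof.
move=> p1 h0; have := powR_gt0 (p - 1) h0 => hp0.
have [xh|hx] := leP `|x| h.
  by apply: (@le_trans _ _ 0); [nra|exact: powR_ge0].
have x0 : 0 <= `|x| by [].
rewrite -(mulr_powRB1 x0 (lt_le_trans ltr01 p1)).
have : h `^ (p - 1) <= `|x| `^ (p - 1).
  by apply: ge0_ler_powR; rewrite ?nnegrE; lra.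
by nra.
Qed.

(** Where [|s| <= t] the last term suffices; elsewhere [|s| ^ p = s ^ 2 * |s| ^ (p - 2)] and the
    exponent [p - 2] is not positive. This replaces a [p]-th moment by a weighted second moment. *)
Lemma powR_weighted_le p t s : 0 <= p -> p <= 2 -> 1 <= t ->
  `|s| `^ p <= s ^+ 2 * t `^ (p - 2) + t `^ p.
Proof.
move=> p0 p2 t1; have t0 : 0 < t by lra.
have [st|ts] := leP `|s| t.
  have : `|s| `^ p <= t `^ p by apply: ge0_ler_powR; rewrite ?nnegrE//; lra.
  by have := powR_ge0 t (p - 2); have := sqr_ge0 s; nra.
have s0 : 0 < `|s| by lra.
have -> : `|s| `^ p = `|s| ^+ 2 * `|s| `^ (p - 2).
  rewrite -powR_mulrn// -powRD; last by rewrite (gt_eqF s0) implybT.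
  by congr (_ `^ _); ring.
rewrite (real_normK (num_real s)).
suff : `|s| `^ (p - 2) <= t `^ (p - 2).
  by have := sqr_ge0 s; have := powR_gt0 p t0; nra.
rewrite -opprB !powRN lef_pV2 ?posrE ?powR_gt0//.
by apply: ge0_ler_powR; rewrite ?nnegrE; lra.
Qed.

Lemma powR_subadd r x y : 0 < r -> r <= 1 -> 0 <= x -> 0 <= y ->
  (x + y) `^ r <= x `^ r + y `^ r.
Proof.
move=> r0 r1 x0 y0.
have [xy0|xyn0] := eqVneq (x + y) 0.
  by rewrite xy0 powR0 ?gt_eqF// addr_ge0 ?powR_ge0.
have xy : 0 < x + y by rewrite lt_neqAle eq_sym xyn0 addr_ge0.
(* [u <= u ^ r] for [u] in [[0, 1]], applied to [x / (x + y)] and [y / (x + y)] *)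
have key z : 0 <= z -> z <= x + y -> z / (x + y) * (x + y) `^ r <= z `^ r.
  move=> z0 zxy; have [->|zn0] := eqVneq z 0; first by rewrite !mul0r powR_ge0.
  have zp : 0 < z by rewrite lt_neqAle eq_sym zn0.
  have -> : z `^ r = (z / (x + y)) `^ r * (x + y) `^ r.
    by rewrite -powRM ?divr_ge0 1?ltW// divfK.
  rewrite ler_pM2r ?powR_gt0//.
  by apply: ger1_powR => //; rewrite divr_gt0//= ler_pdivrMr// mul1r.
have hx := key x x0 ltac:(lra); have hy := key y y0 ltac:(lra).
have -> : (x + y) `^ r = x / (x + y) * (x + y) `^ r + y / (x + y) * (x + y) `^ r.
  by rewrite -mulrDl -mulrDl divff// mul1r.
exact: lerD.
Qed.

Lemma powR_le_1sqr r x : 0 < r -> r <= 1 -> `|x| `^ r <= 1 + x ^+ 2.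
Proof.
move=> r0 r1; rewrite -real_normK ?num_real//.
set y := `|x|; have y0 : 0 <= y by exact: normr_ge0.
have [y1|y1] := leP 1 y.
  have := ler1_powR y1 r1; have := @powR_ge0 R y r; nra.
have : y `^ r <= 1 `^ r by apply: ge0_ler_powR; rewrite ?nnegrE; lra.
by rewrite powR1; have := sqr_ge0 y; nra.
Qed.

End RealInequalities.

(** * Khintchine's lower inequality by averaging over signs *)

Section Khintchine.
Context (R : realType).
Implicit Types (cs : seq R) (x : R).

(** The mean of [f] over all values [x + \sum +- c], that is, a Rademacher expectation written as a
    recursion so that no space of signs is needed. *)
Fixpoint sign_avg (f : R -> R) cs x : R :=
  if cs is c :: cs' then (sign_avg f cs' (x + c) + sign_avg f cs' (x - c)) / 2
  else f x.

Definition sumsq cs := \sum_(c <- cs) c ^+ 2.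

Lemma sumsq_cons c cs : sumsq (c :: cs) = c ^+ 2 + sumsq cs.
Proof. by rewrite /sumsq big_cons. Qed.

Lemma sumsq_ge0 cs : 0 <= sumsq cs.
Proof. by apply: sumr_ge0 => c _; exact: sqr_ge0. Qed.

Lemma le_sign_avg f g cs x : (forall y, f y <= g y) ->
  sign_avg f cs x <= sign_avg g cs x.
Proof.
move=> fg; elim: cs x => //= c cs IH x.
by have := IH (x + c); have := IH (x - c); lra.
Qed.

Lemma sign_avg_lin f g a b cs x :
  sign_avg (fun y => a * f y + b * g y) cs x =
  a * sign_avg f cs x + b * sign_avg g cs x.
Proof. by elim: cs x => //= c cs IH x; rewrite !IH; field. Qed.

Lemma sign_avg_sqr cs x : sign_avg (fun y => y ^+ 2) cs x = x ^+ 2 + sumsq cs.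
Proof.
elim: cs x => /= [x|c cs IH x]; first by rewrite /sumsq big_nil addr0.
by rewrite !IH sumsq_cons; field.
Qed.

(** The shift [x] is carried for the induction; at [x = 0] this is the usual bound of the fourth
    moment by 3 times the square of the second. *)
Lemma sign_avg_pow4 cs x : sign_avg (fun y => y ^+ 4) cs x <=
  x ^+ 4 + 6 * x ^+ 2 * sumsq cs + 3 * sumsq cs ^+ 2.
Proof.
elim: cs x => /= [x|c cs IH x].
  by rewrite /sumsq big_nil expr0n/= !mulr0 !addr0.
rewrite sumsq_cons.
have h1 := IH (x + c); have h2 := IH (x - c).
have := sumsq_ge0 cs; move: h1 h2; set s := sumsq cs => h1 h2 s0.
have : 0 <= c ^+ 4 by rewrite exprn_even_ge0.
have -> : 3 * (c ^+ 2 + s) ^+ 2 = 3 * c ^+ 4 + 6 * (c ^+ 2 * s) + 3 * s ^+ 2 by ring.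
have -> : 6 * x ^+ 2 * (c ^+ 2 + s) = 6 * x ^+ 2 * c ^+ 2 + 6 * x ^+ 2 * s by ring.
have e1 : (x + c) ^+ 4 + (x - c) ^+ 4 =
    2 * x ^+ 4 + 12 * x ^+ 2 * c ^+ 2 + 2 * c ^+ 4 by ring.
have e2 : 6 * (x + c) ^+ 2 * s + 6 * (x - c) ^+ 2 * s =
    12 * x ^+ 2 * s + 12 * (c ^+ 2 * s) by ring.
by lra.
Qed.

Lemma powR_ge_sqr_pow4 (p v : R) : 1 <= p -> p <= 2 -> 0 <= v ->
  v ^+ 2 - v ^+ 4 / 4 <= v `^ p.
Proof.
move=> p1 p2 v0; have p0 : 0 < p by lra.
have v4 : v ^+ 4 = v ^+ 2 * v ^+ 2 by ring.
have [->|vn0] := eqVneq v 0; first by rewrite powR0 ?gt_eqF// !expr0n/= mul0r subrr.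
have vp : 0 < v by rewrite lt_neqAle eq_sym vn0.
have [v1|v1] := leP 1 v.
  apply: (@le_trans _ _ v); last exact: le1r_powR.
  rewrite v4; have : v - v ^+ 2 + v ^+ 2 * v ^+ 2 / 4 = v * (1 - v + v ^+ 3 / 4) by field.
  have : 0 <= 1 - v + v ^+ 3 / 4.
    (* From [(v - 2) ^ 2 >= 0] follows [v ^ 3 / 4 >= v ^ 2 - v], so the left-over is at least
       [(1 - v) ^ 2]. *)
    by have : v ^+ 3 = v * v ^+ 2 by []; have := sqr_ge0 (v - 2); nra.
  by move=> h; have := mulr_ge0 v0 h; lra.
apply: (@le_trans _ _ (v ^+ 2)); first by rewrite v4; have := sqr_ge0 (v ^+ 2); lra.
by rewrite -(powR_mulrn 2 v0); apply: ger_powR => //; rewrite vp ltW.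
Qed.

(** Take [v = |y| / l] with [l] the root of [sumsq cs] in [v ^ 2 - v ^ 4 / 4 <= v ^ p]. The mean of
    [v ^ 2] is 1 and that of [v ^ 4] is at most 3, which leaves [1 - 3 / 4 = 1 / 4]. *)
Lemma khintchine_lower (p : R) cs : 1 <= p -> p <= 2 ->
  sumsq cs `^ (p / 2) / 4 <= sign_avg (fun y => `|y| `^ p) cs 0.
Proof.
move=> p1 p2; have [s0|sn0] := eqVneq (sumsq cs) 0.
  rewrite s0 powR0; last by rewrite gt_eqF// divr_gt0//; lra.
  rewrite mul0r; apply: (@le_trans _ _ (sign_avg (fun=> 0) cs 0)).
    suff -> : forall x, sign_avg (fun=> 0) cs x = 0 by [].
    by elim: cs {s0} => //= c cs IH x; rewrite !IH addr0 mul0r.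
  by apply: le_sign_avg => y; exact: powR_ge0.
have sp : 0 < sumsq cs by rewrite lt_neqAle eq_sym sn0 sumsq_ge0.
set l := Num.sqrt (sumsq cs).
have lp : 0 < l by rewrite sqrtr_gt0.
have l2 : l ^+ 2 = sumsq cs by rewrite sqr_sqrtr// sumsq_ge0.
have -> : sumsq cs `^ (p / 2) = l `^ p.
  rewrite -l2 -powR_mulrn ?ltW// -powRrM; congr (_ `^ _); lra.
(* The coefficients of [l ^ p * (v ^ 2 - v ^ 4 / 4)] as a polynomial in [y], where [v = |y| / l]. *)
pose a := l `^ p / l ^+ 2; pose b := - (l `^ p / (4 * l ^+ 4)).
have lpp := powR_gt0 p lp.
apply: (@le_trans _ _ (sign_avg (fun y => a * y ^+ 2 + b * y ^+ 4) cs 0)).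
  rewrite sign_avg_lin sign_avg_sqr.
  have := sign_avg_pow4 cs 0.
  rewrite !expr0n/= !mulr0 !mul0r !add0r -l2 => h4.
  have b0 : 0 < - b by rewrite opprK divr_gt0// mulr_gt0// exprn_gt0.
  have -> : a * l ^+ 2 = l `^ p by rewrite /a divfK// expf_neq0 ?gt_eqF.
  have : b * (3 * (l ^+ 2) ^+ 2) <= b * sign_avg (fun y => y ^+ 4) cs 0.
    by rewrite ler_nM2l//; lra.
  have -> : b * (3 * (l ^+ 2) ^+ 2) = - (3 / 4 * l `^ p).
    by rewrite /b; field; rewrite gt_eqF.
  by lra.
apply: le_sign_avg => y.
have y0 : 0 <= `|y| / l by rewrite divr_ge0// ltW.
have -> : `|y| `^ p = l `^ p * (`|y| / l) `^ p.
  by rewrite -powRM ?(ltW lp)// mulrCA divff ?gt_eqF// mulr1.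
have -> : a * y ^+ 2 + b * y ^+ 4 =
    l `^ p * ((`|y| / l) ^+ 2 - (`|y| / l) ^+ 4 / 4).
  have -> : y ^+ 4 = `|y| ^+ 4.
    by rewrite -normrX ger0_norm// exprn_even_ge0.
  have -> : y ^+ 2 = `|y| ^+ 2 by rewrite (real_normK (num_real y)).
  by rewrite /a /b; field; rewrite gt_eqF.
by rewrite ler_pM2l//; exact: powR_ge_sqr_pow4.
Qed.

End Khintchine.

(** * Integrable and bounded real functions *)

Section Integration.
Context d (T : measurableType d) (R : realType).
Variable m : {measure set T -> \bar R}.
Implicit Types (f g : T -> R).

Definition intg f := m.-integrable setT (EFin \o f).

Definition bdd f := measurable_fun setT f /\ exists c, forall w, `|f w| <= c.

Local Notation E := (Rintegral m setT).

Lemma intgD f g : intg f -> intg g -> intg (fun w => f w + g w).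
Proof. by move=> hf hg; apply: integrableD hf hg. Qed.

Lemma intgB f g : intg f -> intg g -> intg (fun w => f w - g w).
Proof. by move=> hf hg; apply: integrableB hf hg. Qed.

Lemma intgZ c f : intg f -> intg (fun w => c * f w).
Proof. by move=> hf; apply: integrableZl hf. Qed.

Lemma intg_sum n (f : nat -> T -> R) : (forall i, (i < n)%N -> intg (f i)) ->
  intg (fun w => \sum_(i < n) f i w).
Proof.
elim: n => [|n IH] H.
  by under [X in intg X]eq_fun do rewrite big_ord0; exact: integrable0.
under [X in intg X]eq_fun do rewrite big_ord_recr/=.
by apply: intgD; [apply: IH => i /ltnW; apply: H|apply: H].
Qed.

Lemma le_intg f g : measurable_fun setT f -> intg g ->
  (forall w, `|f w| <= g w) -> intg f.
Proof.
move=> mf ig fg; apply: (le_integrable measurableT _ _ ig).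
  exact/measurable_EFinP.
by move=> w _; rewrite /= lee_fin (le_trans (fg w))// ler_norm.
Qed.

Lemma intg_norm f : intg f -> intg (fun w => `|f w|).
Proof. exact: integrable_norm. Qed.

Lemma bddD f g : bdd f -> bdd g -> bdd (fun w => f w + g w).
Proof.
move=> [mf [c fc]] [mg [c' gc]]; split; first exact: measurable_funD.
exists (c + c') => w; apply: (le_trans (ler_normD _ _)).
exact: lerD.
Qed.

Lemma bddM f g : bdd f -> bdd g -> bdd (fun w => f w * g w).
Proof.
move=> [mf [c fc]] [mg [c' gc]]; split; first exact: measurable_funM.
by exists (c * c') => w; rewrite normrM ler_pM.
Qed.

Lemma bdd_sqr f : bdd f -> bdd (fun w => f w ^+ 2).
Proof. by move=> hf; under [X in bdd X]eq_fun do rewrite expr2; exact: bddM. Qed.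

Lemma bdd_cst c : bdd (fun=> c).
Proof. by split=> //; exists `|c|. Qed.

Lemma bddZ c f : bdd f -> bdd (fun w => c * f w).
Proof. by move=> hf; apply: (bddM (bdd_cst c) hf). Qed.

Lemma bddN f : bdd f -> bdd (fun w => - f w).
Proof.
by move=> /(bddZ (-1)); under [X in bdd X -> _]eq_fun do rewrite mulN1r.
Qed.

Lemma bddB f g : bdd f -> bdd g -> bdd (fun w => f w - g w).
Proof. by move=> hf /bddN; exact: bddD. Qed.

Lemma bdd_indic A : measurable A -> bdd (\1_A : T -> R).
Proof.
move=> mA; split; first exact: measurable_indic.
by exists 1 => w; rewrite indicE; case: (_ \in _); rewrite ?normr1 ?normr0.
Qed.

Lemma bdd_bound f : bdd f -> exists2 c, 0 < c & forall w, `|f w| <= c.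
Proof.
move=> [_ [c fc]]; exists (`|c| + 1) => [|w]; first by rewrite ltr_wpDl.
by apply: (le_trans (fc w)); rewrite (le_trans (ler_norm _))// lerDl.
Qed.

Lemma bdd_bounded f : bdd f -> [bounded f x | x in setT].
Proof.
move=> /bdd_bound[c c0 fc]; exists c; split; first exact: num_real.
by move=> x cx w _; apply: (le_trans (fc w)); rewrite ltW.
Qed.

Lemma intgM_bdd f g : intg f -> bdd g -> intg (fun w => f w * g w).
Proof.
move=> hf hg; have := integrableMl measurableT hf hg.1 (bdd_bounded hg).
by [].
Qed.

Lemma intgMl_bdd f g : bdd f -> intg g -> intg (fun w => f w * g w).
Proof.
by move=> hf ig; under [X in intg X]eq_fun do rewrite mulrC; exact: intgM_bdd.
Qed.

Lemma ED f g : intg f -> intg g -> E (fun w => f w + g w) = E f + E g.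
Proof. exact: RintegralD. Qed.

Lemma EB f g : intg f -> intg g -> E (fun w => f w - g w) = E f - E g.
Proof. exact: RintegralB. Qed.

Lemma EZ c f : intg f -> E (fun w => c * f w) = c * E f.
Proof. exact: RintegralZl. Qed.

Lemma eqE f g : f =1 g -> E f = E g.
Proof. by move=> fg; apply: eq_Rintegral => w _. Qed.

Lemma E_sum n (f : nat -> T -> R) : (forall i, (i < n)%N -> intg (f i)) ->
  E (fun w => \sum_(i < n) f i w) = \sum_(i < n) E (f i).
Proof.
elim: n => [|n IH] H.
  rewrite big_ord0 (@eqE _ (fun=> 0)) => [|w]; last by rewrite big_ord0.
  by rewrite /Rintegral integral0.
rewrite big_ord_recr/= -IH => [|i /ltnW]; last exact: H.
rewrite -ED; first by apply: eqE => w; rewrite big_ord_recr.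
  by apply: intg_sum => i /ltnW; apply: H.
exact: H.
Qed.

Lemma le_E f g : intg f -> intg g -> (forall w, f w <= g w) -> E f <= E g.
Proof. by move=> hf hg fg; apply: le_Rintegral => // w _. Qed.

Lemma norm_E f : intg f -> `|E f| <= E (fun w => `|f w|).
Proof. exact: le_normr_Rintegral. Qed.

Lemma E_ge0 f : (forall w, 0 <= f w) -> 0 <= E f.
Proof. by move=> f0; apply: Rintegral_ge0. Qed.

Lemma EFin_E f : intg f -> (E f)%:E = (\int[m]_w (f w)%:E)%E.
Proof.
by move=> hf; rewrite /Rintegral fineK//; apply: (integrable_fin_num _ hf).
Qed.

(** Only the total mass is fixed, so that the same facts serve for [P] and for each measure
    [mu w]. *)
Hypothesis m1 : m setT = 1%E.

Lemma intg_bdd f : bdd f -> intg f.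
Proof.
move=> hf; apply: measurable_bounded_integrable => //.
- by rewrite m1 ltry.
- by case: hf.
- exact: bdd_bounded.
Qed.

Lemma E_cst c : E (fun=> c) = c.
Proof. by rewrite Rintegral_cst// m1/= mulr1. Qed.

Lemma intg_cst c : intg (fun=> c).
Proof. exact/intg_bdd/bdd_cst. Qed.

Lemma norm_E_le f c : bdd f -> (forall w, `|f w| <= c) -> `|E f| <= c.
Proof.
move=> hf fc; apply: (le_trans (norm_E (intg_bdd hf))).
rewrite -[leRHS](E_cst c); apply: le_E => //; [exact/intg_norm/intg_bdd|exact: intg_cst].
Qed.

End Integration.

(** * Stable convergence to the limit random measure *)

Section ContinuityPoints.
Context (R : realType).

(** A monotone function has countably many discontinuities, whereas an open interval has positive
    Lebesgue measure. *)
Lemma distribution_function_continuity_point (F : R -> R) (a b : R) :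
  distribution_function F -> a < b ->
  exists t, [/\ a < t, t < b & {for t, continuous F}].
Proof.
move=> [ndF rcF _ _] ab.
apply: contrapT => nex.
have sub : `]a, b[%classic `<=` [set x | x \in (`]a, b[) /\ discontinuity F x].
  move=> t/=; rewrite in_itv/= => /andP[at_ tb]; split; first exact/andP.
  have cvl : cvg (F x @[x --> t^'-]).
    apply: nondecreasing_at_left_is_cvgr; near=> x.
      by move=> y z _ _; exact: ndF.
    by exists (F t) => _/= [y + <-]; rewrite in_itv/= => /andP[_ /ltW]; exact: ndF.
  have cvr : cvg (F x @[x --> t^'+]) by apply/cvg_ex; exists (F t); exact: rcF.
  split => //; apply/eqP => lr; apply: nex; exists t; split => //.
  apply/left_right_continuousP; split; last exact: rcF.
  have <- : lim (F x @[x --> t^'-]) = F t by rewrite lr; exact/cvg_lim/rcF.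
  exact: cvl.
have cnt : countable `]a, b[%classic.
  apply: (sub_countable (subset_card_le sub)); apply: discontinuity_countable.
  by move=> x y _ _; exact: ndF.
have := countable_lebesgue_measure0 cnt.
rewrite lebesgue_measure_itv/= lte_fin ab -EFinB => -[].
lra.
Unshelve. all: by end_near. Qed.

End ContinuityPoints.

(** * Stable convergence tested on one function and one weight *)

Section WeakConvergence.
Context d (T : measurableType d) (R : realType) (P : probability T R).
Context (mu : R.-pker T ~> R).
Local Notation E := (Rintegral P setT).
Implicit Types (g h : R -> R) (W : T -> R).

Let P1 : P setT = 1%E := probability_setT P.

(** This is the random variable [gbar] of the overview, a version of the limiting conditional mean
    of [g (X n)]. *)
Definition kmean g w := Rintegral (mu w) setT g.

Lemma kmeanD g h w : bdd g -> bdd h ->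
  kmean (fun x => g x + h x) w = kmean g w + kmean h w.
Proof. by move=> hg hh; rewrite /kmean ED//; apply: intg_bdd => //; exact: prob_kernel. Qed.

Lemma kmeanB g h w : bdd g -> bdd h ->
  kmean (fun x => g x - h x) w = kmean g w - kmean h w.
Proof. by move=> hg hh; rewrite /kmean EB//; apply: intg_bdd => //; exact: prob_kernel. Qed.

Lemma kmeanZ c g w : bdd g -> kmean (fun x => c * g x) w = c * kmean g w.
Proof. by move=> hg; rewrite /kmean EZ//; apply: intg_bdd => //; exact: prob_kernel. Qed.

Lemma kmean_cst c w : kmean (fun=> c) w = c.
Proof. by rewrite /kmean E_cst//; exact: prob_kernel. Qed.

Lemma le_kmean g h w : bdd g -> bdd h -> (forall x, g x <= h x) ->
  kmean g w <= kmean h w.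
Proof. by move=> hg hh gh; apply: le_E => //; apply: intg_bdd => //; exact: prob_kernel. Qed.

Lemma norm_kmean_le g c w : bdd g -> (forall x, `|g x| <= c) -> `|kmean g w| <= c.
Proof. by move=> hg gc; apply: norm_E_le => //; exact: prob_kernel. Qed.

Lemma kmean_indic (B : set R) w : measurable B -> kmean \1_B w = fine (mu w B).
Proof. by move=> mB; rewrite /kmean /Rintegral integral_indic// setIT. Qed.

Lemma bdd_kmean g : bdd g -> bdd (kmean g).
Proof.
move=> hg; have [c c0 gc] := bdd_bound hg.
split; last by exists c => w; exact: norm_kmean_le.
(* Adding the bound [c] makes the integrand nonnegative, as the measurability of kernel integrals
   requires. *)
rewrite (_ : kmean g = fun w => fine (\int[mu w]_x (g x + c)%:E)%E - c); last first.
  apply/funext => w; rewrite -[fine _]/(kmean (fun x => g x + c) w).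
  by rewrite kmeanD// ?kmean_cst ?addrK//; exact: bdd_cst.
apply: measurable_funB => //; apply: measurableT_comp => //=.
apply: measurable_fun_integral_kernel => [U mU|x|].
- exact: measurable_kernel.
- by rewrite lee_fin; have := gc x; rewrite ler_norml => /andP[? _]; lra.
- by apply/measurable_EFinP; apply: measurable_funD => //; case: hg.
Qed.

Context (X : nat -> T -> R).
Hypothesis mX : forall n, measurable_fun setT (X n).

Lemma bdd_comp g n : bdd g -> bdd (fun w => g (X n w)).
Proof.
by move=> [mg [c gc]]; split; [exact: measurableT_comp mg (mX n)|exists c => w].
Qed.

Definition stable g W :=
  (fun n => E (fun w => g (X n w) * W w)) @ \oo --> E (fun w => kmean g w * W w).

Lemma stableD_fun g h W : intg P W -> bdd g -> bdd h ->
  stable g W -> stable h W -> stable (fun x => g x + h x) W.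
Proof.
move=> iW hg hh sg sh; rewrite /stable.
have -> : E (fun w => kmean (fun x => g x + h x) w * W w) =
    E (fun w => kmean g w * W w) + E (fun w => kmean h w * W w).
  rewrite -ED; first by apply: eqE => w; rewrite kmeanD// mulrDl.
    by apply: intgMl_bdd => //; exact: bdd_kmean.
  by apply: intgMl_bdd => //; exact: bdd_kmean.
rewrite [X in X @ _ --> _](_ : _ = fun n =>
   E (fun w => g (X n w) * W w) + E (fun w => h (X n w) * W w)); last first.
  apply/funext => n; rewrite -ED; first by apply: eqE => w; rewrite mulrDl.
    by apply: intgMl_bdd => //; exact: bdd_comp.
  by apply: intgMl_bdd => //; exact: bdd_comp.
exact: (cvgD sg sh).
Qed.

Lemma stableZ_fun c g W : intg P W -> bdd g ->
  stable g W -> stable (fun x => c * g x) W.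
Proof.
move=> iW hg sg; rewrite /stable.
have -> : E (fun w => kmean (fun x => c * g x) w * W w) =
    c * E (fun w => kmean g w * W w).
  rewrite -EZ; first by apply: eqE => w; rewrite kmeanZ// mulrA.
  by apply: intgMl_bdd => //; exact: bdd_kmean.
rewrite [X in X @ _ --> _](_ : _ = fun n => c * E (fun w => g (X n w) * W w)).
  by apply: cvgM => //; exact: cvg_cst.
apply/funext => n; rewrite -EZ; first by apply: eqE => w; rewrite mulrA.
by apply: intgMl_bdd => //; exact: bdd_comp.
Qed.

Lemma stable_cst c W : stable (fun=> c) W.
Proof.
rewrite /stable (@eqE _ _ _ _ _ (fun w => c * W w)); first exact: cvg_cst.
by move=> w; rewrite kmean_cst.
Qed.

Lemma stable_unif g A : measurable A -> bdd g ->
  (forall e : R, 0 < e -> exists h, [/\ bdd h, stable h \1_A & forall x, `|g x - h x| <= e]) ->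
  stable g \1_A.
Proof.
move=> mA hg H; apply/cvgrPdist_le => e e0.
have [h [hh sh gh]] := H (e / 3) ltac:(lra).
move/cvgrPdist_le : sh => /(_ (e / 3) ltac:(lra)); apply: filterS => n hn.
have bA := bdd_indic R mA.
have A1 w : `|\1_A w| <= 1 :> R by rewrite indicE; case: (_ \in _); rewrite ?normr1 ?normr0.
have e3 : 0 <= e / 3 by lra.
have k1 : `|E (fun w => g (X n w) * \1_A w) - E (fun w => h (X n w) * \1_A w)| <= e / 3.
  rewrite -EB; try by apply: intgMl_bdd; [exact: bdd_comp|exact: intg_bdd].
  apply: norm_E_le => //; first by apply: bddB; apply: bddM => //; exact: bdd_comp.
  by move=> w; rewrite -mulrBl normrM -[e / 3]mulr1 ler_pM.
have k2 : `|E (fun w => kmean g w * \1_A w) - E (fun w => kmean h w * \1_A w)| <= e / 3.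
  rewrite -EB; try by apply: intgMl_bdd; [exact: bdd_kmean|exact: intg_bdd].
  apply: norm_E_le => //; first by apply: bddB; apply: bddM => //; exact: bdd_kmean.
  move=> w; rewrite -mulrBl normrM -[e / 3]mulr1 ler_pM// -kmeanB//.
  by apply: norm_kmean_le => //; exact: bddB.
exact: le_dist_third k1 k2 hn.
Qed.

Lemma stableD_wgt g V W : bdd g -> intg P V -> intg P W ->
  stable g V -> stable g W -> stable g (fun w => V w + W w).
Proof.
move=> hg iV iW sV sW; rewrite /stable.
have -> : E (fun w => kmean g w * (V w + W w)) =
    E (fun w => kmean g w * V w) + E (fun w => kmean g w * W w).
  by rewrite -ED; [apply: eqE => w; by rewrite mulrDr| |]; apply: intgMl_bdd => //; exact: bdd_kmean.
rewrite [X in X @ _ --> _](_ : _ = fun n =>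
   E (fun w => g (X n w) * V w) + E (fun w => g (X n w) * W w)); first exact: (cvgD sV sW).
by apply/funext => n; rewrite -ED; [apply: eqE => w; by rewrite mulrDr| |]; apply: intgMl_bdd => //; exact: bdd_comp.
Qed.

Lemma stableZ_wgt g c W : bdd g -> intg P W ->
  stable g W -> stable g (fun w => c * W w).
Proof.
move=> hg iW sW; rewrite /stable.
have -> : E (fun w => kmean g w * (c * W w)) = c * E (fun w => kmean g w * W w).
  by rewrite -EZ; [by apply: eqE => w; rewrite mulrCA|apply: intgMl_bdd => //; exact: bdd_kmean].
rewrite [X in X @ _ --> _](_ : _ = fun n => c * E (fun w => g (X n w) * W w)).
  by apply: cvgM => //; exact: cvg_cst.
by apply/funext => n; rewrite -EZ; [by apply: eqE => w; rewrite mulrCA|apply: intgMl_bdd => //; exact: bdd_comp].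
Qed.

Import HBSimple.

(** Linearity passes from indicators to simple weights. Density of these in [L1] gives the rest:
    replacing [W] by a simple function changes both sides by at most [c] times the [L1] distance,
    uniformly in [n], where [c] bounds [g]. *)
Lemma stable_intg g : bdd g ->
  (forall A, measurable A -> stable g \1_A) -> forall W, intg P W -> stable g W.
Proof.
move=> hg H W iW.
have sf (f : {sfun T >-> R}) : stable g f.
  have [N [y fE]] : exists N (y : nat -> R), forall w,
      f w = \sum_(i < N) y i * \1_(f @^-1` [set y i]) w.
    exists (size (finmap.enum_fset (fset_set (range f)))),
      (nth 0 (finmap.enum_fset (fset_set (range f)))).
    exact: fimfunEord.
  pose D i : set T := f @^-1` [set y i].
  have mD i : measurable (D i) by exact: measurable_sfunP.
  have iD i : intg P (fun w => y i * \1_(D i) w).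
    by apply: intgZ; exact/intg_bdd/bdd_indic.
  rewrite (_ : (f : T -> R) = fun w => \sum_(i < N) y i * \1_(D i) w); last first.
    exact/funext.
  elim: N {fE} => [|k IH].
    rewrite /stable (@eqE _ _ _ _ _ (fun=> 0)) => [|w]; last by rewrite big_ord0 mulr0.
    rewrite [X in X @ _ --> _](_ : _ = fun=> E (fun=> 0)); first exact: cvg_cst.
    by apply/funext => n; apply: eqE => w; rewrite big_ord0 mulr0.
  rewrite (_ : (fun w => \sum_(i < k.+1) _) = fun w =>
      \sum_(i < k) y i * \1_(D i) w +
      y k * \1_(D k) w); last first.
    by apply/funext => w; rewrite big_ord_recr.
  apply: stableD_wgt => //.
    by apply: (intg_sum (f := fun i w => y i * \1_(D i) w)).
  apply: stableZ_wgt => //; first exact/intg_bdd/bdd_indic.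
  exact: H.
have [s_ [is_ _ s_cvg]] := approximation_sfun_integrable measurableT iW.
have [c c0 gc] := bdd_bound hg.
apply/cvgrPdist_le => e e0.
have [k kW] : exists k, E (fun w => `|W w - s_ k w|) <= e / (3 * c).
  have e3c : 0 < e / (3 * c) by rewrite divr_gt0// mulr_gt0.
  have : \forall k \near \oo, (\int[P]_z `|(W z)%:E - (s_ k z)%:E| < (e / (3 * c))%:E)%E.
    have := s_cvg [set u : \bar R | (u < (e / (3 * c))%:E)%E].
    by apply; apply: (@open_ereal_lt' R 0%E); rewrite lte_fin.
  move=> [k _ /(_ k (leqnn _)) kW]; exists k.
  rewrite -lee_fin EFin_E; first exact: ltW.
  by apply: intg_norm; apply: intgB => //; exact: is_.
have iWs : intg P (fun w => W w - s_ k w) by apply: intgB => //; exact: is_.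
have bound f : bdd f -> (forall w, `|f w| <= c) ->
    `|E (fun w => f w * W w) - E (fun w => f w * s_ k w)| <= e / 3.
  move=> hf fc; rewrite -EB; try by apply: intgMl_bdd => //; exact: is_.
  rewrite (@eqE _ _ _ _ _ (fun w => f w * (W w - s_ k w))) => [|w]; last first.
    by rewrite mulrBr.
  apply: le_trans (norm_E _) _; first exact: intgMl_bdd.
  apply: (@le_trans _ _ (E (fun w => c * `|W w - s_ k w|))).
    apply: le_E => [||w]; [exact/intg_norm/intgMl_bdd|exact/intgZ/intg_norm|].
    by rewrite normrM ler_wpM2r.
  rewrite EZ; last exact/intg_norm.
  have -> : e / 3 = c * (e / (3 * c)) by field; rewrite gt_eqF.
  by rewrite ler_pM2l.
have /cvgrPdist_le/(_ (e / 3) ltac:(lra)) := sf (s_ k).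
apply: filterS => n hn.
have k1 := bound _ (bdd_comp n hg) (fun w => gc _).
have k2 := bound _ (bdd_kmean hg) (fun w => norm_kmean_le w hg gc).
exact: le_dist_third k1 k2 hn.
Qed.

End WeakConvergence.

(** * Stable convergence of a determining sequence *)

Section StableConvergence.
Context d (T : measurableType d) (R : realType) (P : probability T R).
Context (mu : R.-pker T ~> R) (X : nat -> T -> R).
Local Notation E := (Rintegral P setT).
Hypothesis mX : forall n, measurable_fun setT (X n).
Hypothesis detX : determining P X.
Hypothesis limX : limit_random_measure P X mu.
Implicit Types (A : set T) (g : R -> R) (t M K : R).

Let P1 : P setT = 1%E := probability_setT P.

(** Conditioning on a null set says nothing, so these weights are treated apart; both sides
    vanish. *)
Lemma stable_null A g : measurable A -> bdd g -> P A = 0%E ->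
  stable P mu X g \1_A.
Proof.
move=> mA hg A0.
have E1A : E \1_A = 0 by rewrite /Rintegral integral_indic// setIT; exact: (congr1 fine A0).
have z (f : T -> R) : bdd f -> E (fun w => f w * \1_A w) = 0.
  move=> hf; have [c c0 fc] := bdd_bound hf.
  have i1 : intg P (\1_A : T -> R) by exact/intg_bdd/bdd_indic.
  have if1 : intg P (fun w => f w * \1_A w) by exact: intgMl_bdd.
  apply/eqP; rewrite -normr_le0; apply: (le_trans (norm_E if1)).
  rewrite -(mulr0 c) -E1A -EZ//; apply: le_E => [||w]; [exact: intg_norm|exact: intgZ|].
  rewrite normrM indicE ler_pM//; case: (_ \in _); by rewrite ?normr1 ?normr0.
rewrite /stable z; last exact: bdd_kmean.
rewrite [X in X @ _ --> _](_ : _ = fun=> 0); first exact: cvg_cst.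
by apply/funext => n; rewrite z//; exact: (bdd_comp mX n hg).
Qed.

(** After multiplication by [P A], the conditional distribution functions become expectations of
    products of indicators, and the defining property of the limit random measure becomes stable
    convergence. *)
Lemma stable_halfline A (F : R -> R) t : measurable A -> (0 < P A)%E ->
  distribution_function F ->
  (forall t : R, {for t, continuous F} ->
    (fun n => cond_prob P A [set w | X n w <= t]) @ \oo --> F t) ->
  {for t, continuous F} ->
  stable P mu X \1_(`]-oo, t]%classic) \1_A.
Proof.
move=> mA A0 dF cF ct.
have PA0 : 0 < fine (P A) by rewrite fine_gt0// A0/= (le_lt_trans (probability_le1 P mA))// ltry.
have mI : measurable (`]-oo, t]%classic : set R) by exact: measurable_itv.
have mXt n : measurable [set w | X n w <= t].
  rewrite (_ : [set w | _] = X n @^-1` `]-oo, t]%classic).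
    by rewrite -[_ @^-1` _]setTI; exact: mX.
  by apply/seteqP; split => w /=; rewrite in_itv.
rewrite /stable.
rewrite [X in X @ _ --> _](_ : _ = fun n =>
    fine (P A) * cond_prob P A [set w | X n w <= t]); last first.
  apply/funext => n; rewrite /cond_prob mulrC divfK ?gt_eqF//.
  rewrite (@eqE _ _ _ _ _ (\1_([set w | X n w <= t] `&` A))).
    by rewrite /Rintegral integral_indic ?setIT//; exact: measurableI.
  by move=> w; rewrite indicI/=; congr (_ * _); rewrite !indicE/=; congr (_%:R);
    apply/idP/idP => /set_mem/=; rewrite in_itv/= => h; apply/mem_set; rewrite /= ?in_itv.
rewrite (_ : E _ = fine (P A) * F t); first exact: cvgM (cvg_cst _) (cF _ ct).
rewrite (limX mA A0 dF cF ct) /cond_expect mulrC divfK ?gt_eqF//.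
rewrite /Rintegral [in RHS]integral_mkcond; congr fine; apply: eq_integral => w _.
rewrite kmean_indic// patchE indicE; case: ifPn => wA; rewrite ?mulr1 ?mulr0//.
rewrite fineK// ge0_fin_numE// (le_lt_trans _ (ltry 1))//.
by rewrite -(@prob_kernel _ _ _ _ _ mu w) le_measure ?inE.
Qed.

(** Step functions with jumps at continuity points of [F] are combinations of half-line indicators,
    hence stable, and they approximate [g] uniformly. Since [g] is constant beyond [M] and [- M],
    finitely many steps are enough. *)
Lemma stable_lipschitz_indic A g M K : measurable A -> bdd g -> 0 < K -> 0 < M ->
  (forall x y, `|g x - g y| <= K * `|x - y|) ->
  (forall x, M <= x -> g x = g M) -> (forall x, x <= - M -> g x = g (- M)) ->
  stable P mu X g \1_A.
Proof.
move=> mA hg K0 M0 lipg gM gNM.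
have [A0|A0] := eqVneq (P A) 0%E; first exact: stable_null.
have {}A0 : (0 < P A)%E by rewrite measure_gt0.
have [F [dF cF]] := detX mA A0.
have iA : intg P (\1_A : T -> R) by exact/intg_bdd/bdd_indic.
apply: stable_unif => // e e0.
(* One continuity point is picked in each interval of length [D], from [- M - D] on. Neighbours are
   less than [2 * D] apart, and over that distance [g] varies by at most [K * (2 * D) = e]. *)
pose D := e / (2 * K).
have D0 : 0 < D by rewrite divr_gt0// mulr_gt0.
have : forall j : nat, exists t, [/\ - M - D + j%:R * D < t,
    t < - M - D + j.+1%:R * D & {for t, continuous F}].
  move=> j; apply: distribution_function_continuity_point => //.
  by rewrite ltrD2l ltr_pM2r// ltr_nat.
move=> /choice[t tP].
have t0 : t 0%N <= - M by have [_ + _] := tP 0%N; rewrite mul1r; lra.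
have tS j : t j < t j.+1 < t j + 2 * D.
  have [a1 a2 _] := tP j; have [b1 b2 _] := tP j.+1.
  move: a1 a2 b1 b2; rewrite -!(natr1 j.+1) -!(natr1 j) => a1 a2 b1 b2.
  by apply/andP; split; nra.
pose s := fix s n x := if n is n'.+1
  then s n' x + (g (t n) - g (t n')) * (1 - \1_(`]-oo, t n']%classic) x) else g (t 0%N).
have bI j : bdd (fun x : R => 1 - \1_(`]-oo, t j]%classic) x : R).
  by apply: bddB; [exact: bdd_cst|exact: bdd_indic].
have bs n : bdd (s n).
  by elim: n => [|n IH]/=; [exact: bdd_cst|apply: bddD => //; exact: bddZ].
have ss n : stable P mu X (s n) \1_A.
  elim: n => [|n IH]; first exact: stable_cst.
  have [_ _ ct] := tP n.
  have bH : bdd (\1_(`]-oo, t n]%classic) : R -> R) by exact: bdd_indic.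
  have sH := stable_halfline mA A0 dF cF ct.
  have sI : stable P mu X (fun x => 1 - \1_(`]-oo, t n]%classic) x) \1_A.
    have bC : bdd (fun _ : R => 1 : R) by exact: bdd_cst.
    have sC : stable P mu X (fun=> 1) \1_A by exact: stable_cst.
    have sN := stableZ_fun mX (c := -1) iA bH sH.
    have := stableD_fun mX iA bC (bddZ (-1) bH) sC sN.
    by under [X in stable _ _ _ X]eq_fun do rewrite mulN1r.
  pose a := g (t n.+1) - g (t n).
  exact (stableD_fun mX iA (bs n) (bddZ a (bI n)) IH
    (stableZ_fun mX (c := a) iA (bI n) sI)).
have I1 n x : t n < x -> 1 - \1_(`]-oo, t n]%classic) x = 1 :> R.
  by move=> tx; rewrite indicE memNset ?subr0//= in_itv/= => /(lt_le_trans tx); rewrite ltxx.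
have I0 n x : x <= t n -> 1 - \1_(`]-oo, t n]%classic) x = 0 :> R.
  by move=> tx; rewrite indicE mem_set ?subrr//= in_itv.
(* The new jump acts only to the right of [t n], where the step function still has the value
   [g (t n)], and moves it to [g (t n.+1)]. *)
have sP n x : (t n < x -> s n x = g (t n)) /\ (x <= t n -> `|g x - s n x| <= e).
  elim: n => [|n [IH1 IH2]]/=.
    split=> // x0; rewrite gNM; last exact: le_trans t0.
    by rewrite gNM ?subrr ?normr0// ltW.
  have /andP[tt1 tt2] := tS n.
  have [xt|tx] := leP x (t n).
    split; first by move=> /(lt_trans tt1)/(le_lt_trans xt); rewrite ltxx.
    by move=> _; rewrite I0// mulr0 addr0; exact: IH2.
  rewrite I1// mulr1 IH1// addrC subrK; split=> // xt.
  apply: (le_trans (lipg _ _)).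
  have -> : e = K * (2 * D) by rewrite /D; field; rewrite gt_eqF.
  by rewrite ler_pM2l// ler_norml; apply/andP; split; lra.
have [N tN] : exists N, M <= t N.
  have [N /ltW hN] : exists N : nat, 2 * M + D < N%:R * D.
    exists (Num.bound ((2 * M + D) / D)); rewrite -ltr_pdivrMr//.
    by apply: archi_boundP; rewrite divr_ge0; lra.
  by exists N; have [+ _ _] := tP N; lra.
exists (s N); split => // x; have [s1 s2] := sP N x.
have [/s2//|tx] := leP x (t N).
have Mx : M <= x by apply: ltW; exact: le_lt_trans tx.
by rewrite s1// (gM x)// (gM (t N))// subrr normr0 ltW.
Qed.

Lemma stable_lipschitz g M K W : bdd g -> 0 < K -> 0 < M ->
  (forall x y, `|g x - g y| <= K * `|x - y|) ->
  (forall x, M <= x -> g x = g M) -> (forall x, x <= - M -> g x = g (- M)) ->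
  intg P W -> stable P mu X g W.
Proof.
move=> hg K0 M0 lipg gM gNM; apply: stable_intg => // A mA.
exact: stable_lipschitz_indic lipg gM gNM.
Qed.

End StableConvergence.

(** * Truncation of the sequence *)

Section Clamp.
Context (R : realType).
Implicit Types (L M x y : R).

(** A Lipschitz truncation, constant beyond [M] and [- M], so that stable convergence applies to it;
    a cut-off by an indicator would not be continuous. *)
Definition clamp M x := Num.max (- M) (Num.min x M).

Lemma clampP M x : 0 <= M ->
  [\/ x <= - M /\ clamp M x = - M, - M <= x /\ x <= M /\ clamp M x = x
    | M <= x /\ clamp M x = M].
Proof.
move=> M0; rewrite /clamp; have [xM|Mx] := leP x M.
  by have [h|h] := leP (- M) x; [constructor 2|constructor 1]; rewrite ?ltW.
by constructor 3; rewrite ltW//; split=> //; apply/max_idPr; lra.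
Qed.

Lemma clamp_id M x : `|x| <= M -> clamp M x = x.
Proof.
rewrite ler_norml => /andP[h1 h2]; rewrite /clamp (min_idPl h2).
exact/max_idPr.
Qed.

Lemma norm_clamp_le M x : 0 <= M -> `|clamp M x| <= M.
Proof.
by move=> M0; rewrite ler_norml; have [[h ->]|[h [h' ->]]|[h ->]] := clampP x M0;
  apply/andP; split; lra.
Qed.

Lemma norm_clamp_le_norm M x : 0 <= M -> `|clamp M x| <= `|x|.
Proof.
move=> M0; have h1 := ler_norm x; have h2 := lerNnormlW (lexx `|x|).
rewrite ler_norml.
by have [[h ->]|[h [h' ->]]|[h ->]] := clampP x M0; apply/andP; split; lra.
Qed.

Lemma clamp_lip M x y : 0 <= M -> `|clamp M x - clamp M y| <= `|x - y|.
Proof.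
move=> M0; have h1 := ler_norm (x - y); have h2 := lerNnormlW (lexx `|x - y|).
rewrite ler_norml.
by have [[h ->]|[h [h' ->]]|[h ->]] := clampP x M0;
   have [[k ->]|[k [k' ->]]|[k ->]] := clampP y M0; apply/andP; split; lra.
Qed.

(** The two truncations have the same sign, and the one at the higher level is the larger in
    absolute value. *)
Lemma clamp_sqr_le_mul L M x : 0 <= L -> L <= M ->
  clamp L x ^+ 2 <= clamp M x * clamp L x.
Proof.
move=> L0 LM; have M0 : 0 <= M by lra.
by have [[h ->]|[h [h' ->]]|[h ->]] := clampP x L0;
   have [[k ->]|[k [k' ->]]|[k ->]] := clampP x M0; nra.
Qed.

Lemma clamp_ge M x : 0 <= M -> M <= x -> clamp M x = M.
Proof. by move=> M0 h; have [[k ->]|[k [k' ->]]|[k ->]] := clampP x M0; lra. Qed.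

Lemma clamp_le M x : 0 <= M -> x <= - M -> clamp M x = - M.
Proof. by move=> M0 h; have [[k ->]|[k [k' ->]]|[k ->]] := clampP x M0; lra. Qed.

Lemma norm_sub_clamp_le M x : 0 <= M -> `|x - clamp M x| <= `|x|.
Proof.
move=> M0; have h1 := ler_norm x; have h2 := lerNnormlW (lexx `|x|).
rewrite ler_norml.
by have [[h ->]|[h [h' ->]]|[h ->]] := clampP x M0; apply/andP; split; lra.
Qed.

Lemma bdd_clamp M : 0 <= M -> bdd (clamp M).
Proof.
move=> M0; split; last by exists M => x; exact: norm_clamp_le.
by apply: measurable_maxr => //; exact: measurable_minr.
Qed.

Lemma bdd_clamp2 L M : 0 <= L -> 0 <= M -> bdd (fun x => clamp M x * clamp L x).
Proof. by move=> L0 M0; apply: bddM; exact: bdd_clamp. Qed.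

End Clamp.

(** * Consequences of normalization, uniform integrability and weak convergence *)

Section LpSequence.
Context d (T : measurableType d) (R : realType) (P : probability T R).
Context (mu : R.-pker T ~> R) (X : nat -> T -> R) (p : R).
Local Notation E := (Rintegral P setT).
Hypothesis p1 : 1 <= p.
Hypothesis p2 : p < 2.
Hypothesis mX : forall n, measurable_fun setT (X n).
Hypothesis detX : determining P X.
Hypothesis limX : limit_random_measure P X mu.
Hypothesis normX : forall n, Lnorm P p%:E (EFin \o X n) = 1%E.
Hypothesis uiX : uniformly_integrable P (fun n w => `|X n w| `^ p).
Hypothesis wX : weakly_to_zero P p X.

Let P1 : P setT = 1%E := probability_setT P.
Let p0 : 0 < p := lt_le_trans ltr01 p1.
Let p2' : p <= 2 := ltW p2.

Lemma stable_clamp M W : 0 < M -> intg P W -> stable P mu X (clamp M) W.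
Proof.
move=> M0 iW; have M0' := ltW M0.
apply: (@stable_lipschitz _ _ _ _ _ _ mX detX limX _ M 1) => //.
- exact: bdd_clamp.
- by move=> x y; rewrite mul1r clamp_lip.
- by move=> x h; rewrite !clamp_ge.
- by move=> x h; rewrite !clamp_le.
Qed.

(** For [L = M] this concerns truncated second moments; two different levels occur in the covariance
    used for the lower bound. *)
Lemma stable_clamp2 L M W : 0 < L -> L <= M -> intg P W ->
  stable P mu X (fun x => clamp M x * clamp L x) W.
Proof.
move=> L0 LM iW; have L0' := ltW L0; have M0 : 0 < M by lra.
have M0' := ltW M0.
apply: (@stable_lipschitz _ _ _ _ _ _ mX detX limX _ M (2 * M)) => //.
- exact: bdd_clamp2.
- by rewrite mulr_gt0.
- move=> x y.
  have -> : clamp M x * clamp L x - clamp M y * clamp L y =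
    clamp M x * (clamp L x - clamp L y) + (clamp M x - clamp M y) * clamp L y by ring.
  apply: (le_trans (ler_normD _ _)); rewrite !normrM.
  have := clamp_lip x y L0'; have := clamp_lip x y M0'.
  have := norm_clamp_le x M0'; have := norm_clamp_le y L0'.
  have := normr_ge0 (clamp M x); have := normr_ge0 (clamp L y).
  have := normr_ge0 (clamp M x - clamp M y); have := normr_ge0 (clamp L x - clamp L y).
  by nra.
- by move=> x h; rewrite !clamp_ge//; lra.
- by move=> x h; rewrite !clamp_le//; lra.
Qed.

Lemma measurable_norm_powR (f : T -> R) (r : R) : measurable_fun setT f ->
  measurable_fun setT (fun w => `|f w| `^ r).
Proof.
move=> mf; apply: (measurableT_comp (@measurable_powR R r)).
exact: measurableT_comp.
Qed.

Lemma intX_powR n : (\int[P]_w (`|X n w| `^ p)%:E = 1)%E.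
Proof.
have pn0 : p != 0 by rewrite gt_eqF.
have := @poweR_Lnorm _ _ _ P (EFin \o X n) p pn0.
by rewrite normX poweR1r => ->; apply: eq_integral => w _; rewrite -poweR_EFin.
Qed.

Lemma intg_powR n : intg P (fun w => `|X n w| `^ p).
Proof.
apply/integrableP; split; first by apply/measurable_EFinP; exact: measurable_norm_powR.
under eq_integral do rewrite /= ger0_norm ?powR_ge0//.
by rewrite intX_powR ltry.
Qed.

Lemma E_powR n : E (fun w => `|X n w| `^ p) = 1.
Proof. by rewrite /Rintegral intX_powR. Qed.

Lemma le_1powR (x : R) : `|x| <= 1 + `|x| `^ p.
Proof.
have [x1|x1] := leP 1 `|x|; first by have := le1r_powR x1 p1; lra.
by have := powR_ge0 `|x| p; lra.
Qed.

Lemma intgX n : intg P (X n).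
Proof.
apply: (@le_intg _ _ _ _ _ (fun w => 1 + `|X n w| `^ p)) => //.
  by apply: intgD; [exact: intg_cst|exact: intg_powR].
by move=> w; exact: le_1powR.
Qed.

Lemma bddX_clamp n M : 0 <= M -> bdd (fun w => clamp M (X n w)).
Proof. by move=> M0; apply: (bdd_comp mX n (bdd_clamp M0)). Qed.

Lemma intgX_clamp n M : 0 <= M -> intg P (fun w => X n w - clamp M (X n w)).
Proof. by move=> M0; apply: intgB; [exact: intgX|exact/intg_bdd/bddX_clamp]. Qed.

Lemma intg_powR_clamp n M : 0 <= M ->
  intg P (fun w => `|X n w - clamp M (X n w)| `^ p).
Proof.
move=> M0; apply: (@le_intg _ _ _ _ _ (fun w => `|X n w| `^ p)) => //.
- by apply: measurable_norm_powR; apply: measurable_funB => //; case: (bddX_clamp n M0).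
- exact: intg_powR.
- move=> w; rewrite ger0_norm ?powR_ge0//; apply: ge0_ler_powR; rewrite ?nnegrE ?(ltW p0)//.
  exact: norm_sub_clamp_le.
Qed.

(** Uniform integrability cuts where [|X n| ^ p] is large, this where [|X n|] is large. Once
    [c >= 1] the second set lies in the first, because [|x| <= |x| ^ p] for [|x| >= 1]. *)
Lemma ui_level (e : R) : 0 < e -> exists2 c : R, 1 <= c &
  forall n, E (fun w => `|X n w| `^ p * \1_[set w | c < `|X n w|] w) <= e.
Proof.
move=> e0; have [c ce] := uiX e0; exists (Num.max 1 c).
  by rewrite le_max lexx.
move=> n; rewrite -lee_fin; apply: le_trans (ce n).
set S := [set w | _ < `| _ `^ _| ].
have aE w : `| `|X n w| `^ p| = `|X n w| `^ p by apply: ger0_norm; exact: powR_ge0.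
have mXn : measurable_fun setT (fun w => `|X n w|) by exact: measurableT_comp.
have mS : measurable S.
  rewrite (_ : S = [set w | c < `|X n w| `^ p]); last first.
    by apply/seteqP; split=> w; rewrite /S/= aE.
  rewrite -[X in measurable X]setTI.
  by apply: measurable_fun_ltr => //; exact: measurable_norm_powR.
have mB : measurable [set w | Num.max 1 c < `|X n w|].
  by rewrite -[X in measurable X]setTI; exact: measurable_fun_ltr.
rewrite EFin_E; last by apply: intgM_bdd; [exact: intg_powR|exact: bdd_indic].
under [leRHS]eq_integral do rewrite aE.
rewrite [leRHS]integral_mkcond; apply: ge0_le_integral => //.
- apply/measurable_EFinP; apply: measurable_funM; first exact: measurable_norm_powR.
  exact: measurable_indic.
- apply/measurable_restrict => //; rewrite setTI; apply/measurable_EFinP.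
  by apply: measurable_funTS; exact: measurable_norm_powR.
move=> w _; rewrite indicE; case: (boolP (_ \in _)) => [|_]; last first.
  by rewrite mulr0 patchE; case: ifPn => _ //; rewrite lee_fin powR_ge0.
move=> /set_mem/=; rewrite gt_max => /andP[x1 cx].
rewrite mulr1 patchE mem_set//.
rewrite /S/= aE; apply: (lt_le_trans cx).
by apply: le1r_powR => //; exact: ltW.
Qed.

(** The truncation error vanishes where [|X n| <= c]. Elsewhere [|X n| > c >= 1], and both the error
    and its [p]-th power are at most [|X n| ^ p]. *)
Lemma clamp_tail (e : R) : 0 < e -> exists2 M0 : R, 1 <= M0 & forall M n, M0 <= M ->
  E (fun w => `|X n w - clamp M (X n w)| `^ p) <= e /\
  E (fun w => `|X n w - clamp M (X n w)|) <= e.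
Proof.
move=> e0; have [c c1 ce] := ui_level e0; exists c => // M n cM.
have M0 : 0 <= M by lra.
have mB : measurable [set w | c < `|X n w|].
  by rewrite -[X in measurable X]setTI; apply: measurable_fun_ltr => //; exact: measurableT_comp.
have ig : intg P (fun w => `|X n w| `^ p * \1_[set w | c < `|X n w|] w).
  by apply: intgM_bdd; [exact: intg_powR|exact: bdd_indic].
have key w : `|X n w| <= c \/ \1_[set w | c < `|X n w|] w = 1 :> R /\ 1 <= `|X n w|.
  have [|cx] := leP `|X n w| c; first by left.
  by right; rewrite indicE mem_set//; split=> //; lra.
have pge := powR_ge0.
split; apply: le_trans (ce n); apply: le_E => //.
- exact: intg_powR_clamp.
- move=> w; have [xc|[-> x1]] := key w.
    rewrite clamp_id; last lra.
    by rewrite subrr normr0 powR0 ?gt_eqF// mulr_ge0 ?powR_ge0.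
  rewrite mulr1; apply: ge0_ler_powR; rewrite ?nnegrE ?(ltW p0)//.
  exact: norm_sub_clamp_le.
- by apply: intg_norm; exact: intgX_clamp.
- move=> w; have [xc|[-> x1]] := key w.
    rewrite clamp_id; last lra.
    by rewrite subrr normr0 mulr_ge0 ?powR_ge0.
  rewrite mulr1; apply: le_trans (le1r_powR x1 p1).
  exact: norm_sub_clamp_le.
Qed.

(** At most half of the unit [p]-th moment sits above the level. Below it
    [|x| ^ p <= 1 / 4 + x ^ 2], which leaves [1 - 1 / 2 - 1 / 4] for the truncated square. *)
Lemma clamp_sqr_lower : exists2 L : R, 1 <= L &
  forall n, 1 / 4 <= E (fun w => clamp L (X n w) ^+ 2).
Proof.
have h0 : 0 < 1 / 2 :> R by lra.
have [c c1 ce] := ui_level h0; exists c => // n.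
have c0 : 0 <= c by lra.
have mB : measurable [set w | c < `|X n w|].
  by rewrite -[X in measurable X]setTI; apply: measurable_fun_ltr => //; exact: measurableT_comp.
have ig : intg P (fun w => `|X n w| `^ p * \1_[set w | c < `|X n w|] w).
  by apply: intgM_bdd; [exact: intg_powR|exact: bdd_indic].
have ic : intg P (fun w => clamp c (X n w) ^+ 2).
  by apply: intg_bdd => //; apply: bdd_sqr; exact: bddX_clamp.
suff : 1 <= E (fun w => `|X n w| `^ p * \1_[set w | c < `|X n w|] w) +
    (1 / 4 + E (fun w => clamp c (X n w) ^+ 2)) by have := ce n; lra.
have i4 : intg P (fun=> 1 / 4 : R) by exact: intg_cst.
have -> : 1 / 4 + E (fun w => clamp c (X n w) ^+ 2) =
    E (fun w => 1 / 4 + clamp c (X n w) ^+ 2).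
  by rewrite ED//; congr (_ + _); rewrite E_cst.
rewrite -ED//; last exact: intgD.
rewrite -{1}(E_powR n); apply: le_E; first exact: intg_powR.
  by apply: intgD => //; exact: intgD.
move=> w; rewrite indicE; case: (boolP (_ \in _)) => [_|/negP xc].
  by rewrite mulr1 lerDl addr_ge0 ?sqr_ge0//; lra.
rewrite mulr0 add0r clamp_id; first exact: powR_le_quarter_sqr.
by rewrite leNgt; apply/negP => h; apply: xc; exact/mem_set.
Qed.

(** A bounded function belongs to the conjugate Lebesgue space, both for a finite conjugate exponent
    and for [+oo], the case [p = 1]. *)
Lemma weak_null Z : bdd Z -> (fun n => E (fun w => X n w * Z w)) @ \oo --> (0:R).
Proof.
move=> hZ; have [c c0 Zc] := bdd_bound hZ.
have := wX hZ.1; have -> : (Lnorm P (conj_exp p) (EFin \o Z) < +oo)%E.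
  rewrite unlock /conj_exp; case: ifPn => [_|pn1] /=.
    rewrite P1 lte01; apply: (@le_lt_trans _ _ c%:E); last exact: ltry.
    by apply/ess_supP; apply: aeW => w /=; rewrite lee_fin.
  apply: poweR_lty; set q := p / (p - 1).
  have q0 : 0 <= q by apply: divr_ge0; [exact: ltW|rewrite subr_ge0].
  apply: (@le_lt_trans _ _ (\int[P]_w (c `^ q)%:E)%E).
    apply: ge0_le_integral => //.
    - by apply/measurable_EFinP; apply: measurable_norm_powR; case: hZ.
    - by move=> w _; rewrite lee_fin; apply: ge0_ler_powR; rewrite ?nnegrE// ltW.
  rewrite integral_cst//; have -> : ((c `^ q)%:E * P setT = (c `^ q)%:E)%E.
    by rewrite [X in (_ * X)%E]P1 mule1.
  exact: ltry.
by move=> /(_ isT)/fine_cvgP[].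
Qed.

End LpSequence.

(** * Necessity *)

Section SquareFunction.
Context d (T : measurableType d) (R : realType) (P : probability T R) (p : R).
Local Notation E := (Rintegral P setT).
Hypothesis p1 : 1 <= p.
Hypothesis p2 : p < 2.

(** Fubini over the signs, by induction on the number [r] of signs being averaged: the first [k] are
    frozen in [c], and averaging over the next one takes half the sum of two frozen cases. *)
Lemma E_sign_avg_le (y : nat -> T -> R) (C : R) N :
  (forall c : nat -> R, (forall j, c j ^+ 2 = 1) ->
    intg P (fun w => `|\sum_(j < N) c j * y j w| `^ p) /\
    E (fun w => `|\sum_(j < N) c j * y j w| `^ p) <= C) ->
  forall r k (c : nat -> R), (k + r)%N = N -> (forall j, c j ^+ 2 = 1) ->
  let F w := sign_avg (fun x => `|x| `^ p) [seq y j w | j <- iota k r]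
                (\sum_(j < k) c j * y j w) in
  intg P F /\ E F <= C.
Proof.
move=> H; elim=> [|r IH] k c /=; first by rewrite addn0 => ->; exact: H.
rewrite -addSnnS => krN c1.
have step (e : R) : e ^+ 2 = 1 ->
    let c' j := if (j < k)%N then c j else e in
    (forall j, c' j ^+ 2 = 1) /\
    forall w, \sum_(j < k.+1) c' j * y j w = \sum_(j < k) c j * y j w + e * y k w.
  move=> e1; split=> [j|w]; first by case: ifP.
  rewrite big_ord_recr/= ltnn; congr (_ + _); apply: eq_bigr => j _.
  by rewrite ltn_ord.
have [cp1 cpE] := step 1 (expr1n _ _).
have [cm1 cmE] := step (- 1) ltac:(by rewrite sqrrN expr1n).
have [ip Ep] := IH _ _ krN cp1; have [im Em] := IH _ _ krN cm1.
pose Fp := fun w => sign_avg (fun x => `|x| `^ p) [seq y j w | j <- iota k.+1 r]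
                (\sum_(j < k) c j * y j w + y k w).
pose Fm := fun w => sign_avg (fun x => `|x| `^ p) [seq y j w | j <- iota k.+1 r]
                (\sum_(j < k) c j * y j w - y k w).
have {}ip : intg P Fp by under [Fp]eq_fun do rewrite -[y k _]mul1r -cpE.
have {}im : intg P Fm by under [Fm]eq_fun do rewrite -[- y k _]mulN1r -cmE.
have {}Ep : E Fp <= C by under [Fp]eq_fun do rewrite -[y k _]mul1r -cpE.
have {}Em : E Fm <= C by under [Fm]eq_fun do rewrite -[- y k _]mulN1r -cmE.
have FE w : (Fp w + Fm w) / 2 = 2^-1 * (Fp w + Fm w) by rewrite mulrC.
split.
  by under [X in intg _ X]eq_fun do rewrite FE; apply: intgZ; exact: intgD.
under [X in E X]eq_fun do rewrite FE.
by rewrite EZ ?ED//; [lra|exact: intgD].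
Qed.

(** Khintchine's inequality is applied at each [w] and then integrated; the factor 4 is the inverse
    of its constant. *)
Lemma E_sumsq_le (y : nat -> T -> R) (C : R) N :
  (forall j, measurable_fun setT (y j)) ->
  (forall c : nat -> R, (forall j, c j ^+ 2 = 1) ->
    intg P (fun w => `|\sum_(j < N) c j * y j w| `^ p) /\
    E (fun w => `|\sum_(j < N) c j * y j w| `^ p) <= C) ->
  intg P (fun w => (\sum_(j < N) y j w ^+ 2) `^ (p / 2)) /\
  E (fun w => (\sum_(j < N) y j w ^+ 2) `^ (p / 2)) <= 4 * C.
Proof.
move=> my H.
have [] := E_sign_avg_le H (c := fun=> 1) (r := N) (k := 0%N) erefl (fun=> expr1n _ _).
set F := (fun w => sign_avg _ _ _) => iF EF.
have key w : (\sum_(j < N) y j w ^+ 2) `^ (p / 2) <= 4 * F w.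
  have := khintchine_lower [seq y j w | j <- iota 0 N] p1 (ltW p2).
  rewrite /F big_ord0 /sumsq big_map.
  have iotaE : iota 0 N = index_iota 0 N by rewrite /index_iota subn0.
  by rewrite {1}iotaE big_mkord; lra.
have ig : intg P (fun w => (\sum_(j < N) y j w ^+ 2) `^ (p / 2)).
  apply: (@le_intg _ _ _ _ _ (fun w => 4 * F w)); last 2 first.
  - exact: intgZ.
  - by move=> w; rewrite ger0_norm ?powR_ge0.
  apply: (measurableT_comp (@measurable_powR R (p / 2))).
  apply: (@measurable_sum _ _ _ setT _ _ (fun (j : 'I_N) w => y j w ^+ 2)) => j.
  exact: measurable_funX.
split=> //; apply: (@le_trans _ _ (E (fun w => 4 * F w))).
  by apply: le_E => //; exact: intgZ.
by rewrite EZ// ler_pM2l.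
Qed.

(** Estimates for initial segments pass to further subsequences by giving the skipped indices the
    coefficient 0. *)
Lemma powR_norm_sum_subseq (x : nat -> T -> R) (f : nat -> nat) (K : R) :
  (forall i j, (i < j)%N -> (f i < f j)%N) ->
  (forall m (a : nat -> R), intg P (fun w => `|\sum_(i < m) a i * x i w| `^ p) /\
     E (fun w => `|\sum_(i < m) a i * x i w| `^ p)
       <= K * (\sum_(i < m) a i ^+ 2) `^ (p / 2)) ->
  forall N (c : nat -> R), intg P (fun w => `|\sum_(j < N) c j * x (f j) w| `^ p) /\
     E (fun w => `|\sum_(j < N) c j * x (f j) w| `^ p)
       <= K * (\sum_(j < N) c j ^+ 2) `^ (p / 2).
Proof.
move=> fS H N c.
(* The coefficient [c j] is placed at position [f j]. As [f] is strictly increasing, all positions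
   with [j < N] lie below [f N], the length used. *)
pose a i := \sum_(j < N) c j * (i == f j)%:R.
have finj i j : (f i == f j) = (i == j).
  by have [/fS/ltn_eqF ->|/fS/gtn_eqF ->|->] := ltngtP i j; rewrite ?eqxx.
have af j : (j < N)%N -> a (f j) = c j.
  move=> jN; rewrite /a (bigD1 (Ordinal jN))//= eqxx mulr1 big1 ?addr0// => i.
  by rewrite -val_eqE/= => /negPf; rewrite eq_sym finj eq_sym => ->; rewrite mulr0.
have sumE (u : nat -> R) : \sum_(i < f N) a i * u i = \sum_(j < N) c j * u (f j).
  under eq_bigr do rewrite mulr_suml.
  rewrite exchange_big/=; apply: eq_bigr => j _.
  rewrite (bigD1 (Ordinal (fS _ _ (ltn_ord j))))//= eqxx mulr1 big1 ?addr0// => i.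
  by rewrite -val_eqE/= => /negPf ->; rewrite mulr0 mul0r.
have aE : \sum_(i < f N) a i ^+ 2 = \sum_(j < N) c j ^+ 2.
  under eq_bigr do rewrite expr2.
  by rewrite (sumE a); apply: eq_bigr => j _; rewrite af ?expr2.
have [] := H (f N) a; rewrite aE.
by under [X in intg _ X]eq_fun do rewrite (sumE (x ^~ _));
   under [X in E X]eq_fun do rewrite (sumE (x ^~ _)).
Qed.

End SquareFunction.

(** * The second moment of the limit measure from the upper estimate *)

Section Necessity.
Context d (T : measurableType d) (R : realType) (P : probability T R).
Context (mu : R.-pker T ~> R) (X : nat -> T -> R) (p : R).
Local Notation E := (Rintegral P setT).
Hypothesis p1 : 1 <= p.
Hypothesis p2 : p < 2.
Hypothesis mX : forall n, measurable_fun setT (X n).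
Hypothesis detX : determining P X.
Hypothesis limX : limit_random_measure P X mu.

Let P1 : P setT = 1%E := probability_setT P.

Context (nk : nat -> nat) (K : R).
Hypothesis nkS : forall k, (nk k < nk k.+1)%N.
Hypothesis upper : forall m (a : nat -> R),
  intg P (fun w => `|\sum_(i < m) a i * X (nk i) w| `^ p) /\
  E (fun w => `|\sum_(i < m) a i * X (nk i) w| `^ p)
    <= K * (\sum_(i < m) a i ^+ 2) `^ (p / 2).

Section Truncated.
Context (M : R).
Hypothesis M0 : 0 < M.

Let g (x : R) := clamp M x * clamp M x.
Let h n w := g (X (nk n) w) - kmean mu g w.

Let g_ge0 x : 0 <= g x. Proof. by rewrite /g -expr2 sqr_ge0. Qed.

Let bg : bdd g. Proof. exact: bdd_clamp2 (ltW M0) (ltW M0). Qed.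

Let g_le x : `|g x| <= M ^+ 2.
Proof. by rewrite normrM expr2 ler_pM// norm_clamp_le// ltW. Qed.

Let bh n : bdd (h n).
Proof. by apply: bddB; [exact: (bdd_comp mX (nk n) bg)|exact: bdd_kmean]. Qed.

Let kmean_ge0 w : 0 <= kmean mu g w. Proof. exact: E_ge0. Qed.

Let h_le n w : `|h n w| <= M ^+ 2.
Proof.
have := g_ge0 (X (nk n) w); have := kmean_ge0 w.
have := norm_kmean_le mu w bg g_le; have := g_le (X (nk n) w).
rewrite /h !ler_norml => /andP[_ a1] /andP[_ a2] a3 a4.
by apply/andP; split; lra.
Qed.

Let h_null (W : T -> R) (e : R) : bdd W -> 0 < e ->
  \forall n \near \oo, `|E (fun w => h n w * W w)| <= e.
Proof.
move=> bW e0; have iW := intg_bdd P1 bW.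
have /cvgrPdist_le/(_ e e0)[N _ HN] := stable_clamp2 mX detX limX M0 (lexx M) iW.
have nkge k : (k <= nk k)%N by elim: k => // k IH; exact: leq_ltn_trans (nkS k).
exists N => // n /= Nn.
have := HN (nk n) (leq_trans Nn (nkge n)).
rewrite distrC -EB.
- by congr (_ <= _); congr (`|_|); apply: eqE => w; rewrite mulrBl.
- by apply: intgMl_bdd => //; exact: (bdd_comp mX (nk n) bg).
- by apply: intgMl_bdd => //; exact: bdd_kmean.
Qed.

(** With this rate, the [i] correlations of a new term with the earlier ones add up to at most
    [i / (i + 1) <= 1]. *)
Let selection : exists f : nat -> nat, forall i j, (j < i)%N -> (f j < f i)%N /\
  `|E (fun w => h (f i) w * h (f j) w)| <= i.+1%:R^-1.
Proof.
pose Q (s : seq nat) n := forall i, i \in s ->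
  (i < n)%N /\ `|E (fun w => h n w * h i w)| <= (size s).+1%:R^-1.
have [|f fQ] := @sequential_choice _ Q.
  move=> s; have : \forall n \near \oo, Q s n.
    apply: near_in_seq => i _; near=> n; split; near: n.
      exact: nbhs_infty_gt.
    by apply: h_null => //; rewrite invr_gt0.
  by move=> [n _ /(_ n (leqnn n))]; exists n.
exists f => i j ji.
have := fQ i (f j); rewrite size_mkseq; apply.
by apply/mapP; exists j; rewrite // mem_iota.
Unshelve. all: by end_near. Qed.

(** Pointwise [kmean mu g <= SS / N + |S N / N|], and the power [p / 2 <= 1] is subadditive. The
    square function contributes [4 * K] and the almost orthogonal average [1 + 1]. The bound is free
    of [M], so the truncation can be removed. *)
Lemma E_kmean_clamp_powR_le : E (fun w => kmean mu g w `^ (p / 2)) <= 4 * K + 2.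
Proof.
have [f fP] := selection.
have fS i j : (i < j)%N -> (f i < f j)%N by move=> /fP[].
have r0 : 0 < p / 2 by rewrite divr_gt0// (lt_le_trans ltr01 p1).
have r1 : p / 2 <= 1 by rewrite ler_pdivrMr// mul1r ltW.
pose B := M ^+ 2.
have B0 : 0 < B by rewrite exprn_gt0.
pose S n w := \sum_(j < n) h (f j) w.
have bS n : bdd (S n).
  elim: n => [|n IH]; rewrite /S.
    by under [X in bdd X]eq_fun do rewrite big_ord0; exact: bdd_cst.
  by under [X in bdd X]eq_fun do rewrite big_ord_recr/=; exact: bddD.
have iS n : intg P (fun w => S n w ^+ 2) by apply: intg_bdd => //; exact: bdd_sqr.
have ES n : E (fun w => S n w ^+ 2) <= n%:R * (B ^+ 2 + 2).
  elim: n => [|n IH].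
    by rewrite (@eqE _ _ _ _ _ (fun=> 0)) ?E_cst ?mul0r// => w; rewrite /S big_ord0 expr0n.
  have ih : intg P (fun w => h (f n) w ^+ 2) by apply: intg_bdd => //; exact: bdd_sqr.
  have ish : intg P (fun w => h (f n) w * S n w) by apply: intg_bdd => //; exact: bddM.
  have i2sh : intg P (fun w => 2 * (h (f n) w * S n w)) by exact: intgZ.
  have -> : E (fun w => S n.+1 w ^+ 2) =
      E (fun w => S n w ^+ 2) + 2 * E (fun w => h (f n) w * S n w) + E (fun w => h (f n) w ^+ 2).
    rewrite -EZ// -ED// -ED//; last exact: intgD.
    by apply: eqE => w; rewrite {1}/S big_ord_recr/= -/(S n w); ring.
  have Eh : E (fun w => h (f n) w ^+ 2) <= B ^+ 2.
    rewrite -[leRHS](E_cst P1); apply: le_E => // [|w]; first exact: intg_cst.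
    rewrite -(real_normK (num_real (h _ _))); apply: ler_pM => //; exact: h_le.
  have Esh : E (fun w => h (f n) w * S n w) <= 1.
    have -> : E (fun w => h (f n) w * S n w) = \sum_(j < n) E (fun w => h (f n) w * h (f j) w).
      rewrite -(E_sum (f := fun j w => h (f n) w * h (f j) w)).
        by apply: eqE => w; rewrite mulr_sumr.
      by move=> i _; apply: intg_bdd => //; exact: bddM.
    apply: (@le_trans _ _ (\sum_(j < n) n.+1%:R^-1)).
      by apply: ler_sum => j _; have [_] := fP _ _ (ltn_ord j); exact: le_trans (ler_norm _).
    by rewrite sumr_const card_ord -[_ *+ _]mulr_natr mulrC ler_pdivrMr// mul1r ler_nat.
  by rewrite -natr1; lra.
(* Then [E (S N ^ 2) <= N * (B ^ 2 + 2) <= N ^ 2], so [S N / N] has second moment at most 1. Here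
   [N] depends on [M], but the final bound does not. *)
have [N NB] : exists N : nat, B ^+ 2 + 2 <= N%:R.
  exists (Num.bound (B ^+ 2 + 2)); apply/ltW/archi_boundP.
  by have := sqr_ge0 B; lra.
have N0 : 0 < N%:R :> R by apply: lt_le_trans NB; have := sqr_ge0 B; lra.
pose SS w := \sum_(j < N) X (nk (f j)) w ^+ 2.
have SS0 w : 0 <= SS w by apply: sumr_ge0 => j _; exact: sqr_ge0.
have [iSS ESS] : intg P (fun w => SS w `^ (p / 2)) /\
    E (fun w => SS w `^ (p / 2)) <= 4 * (K * N%:R `^ (p / 2)).
  apply: (E_sumsq_le p1 p2 (y := fun j => X (nk (f j)))) => // c c1.
  have := powR_norm_sum_subseq (x := fun i => X (nk i)) fS upper N c.
  by under eq_bigr do rewrite c1; rewrite sumr_const card_ord.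
have NR : 0 < N%:R `^ (p / 2) :> R by exact: powR_gt0.
have pt w : kmean mu g w `^ (p / 2) <=
    (N%:R `^ (p / 2))^-1 * SS w `^ (p / 2) + (1 + (N%:R ^+ 2)^-1 * S N w ^+ 2).
  have avg : kmean mu g w <= SS w / N%:R + `|S N w / N%:R|.
    have SE : S N w = \sum_(j < N) g (X (nk (f j)) w) - kmean mu g w *+ N.
      by rewrite /S/h sumrB sumr_const card_ord.
    have SSg : \sum_(j < N) g (X (nk (f j)) w) <= SS w.
      apply: ler_sum => j _; rewrite /g -expr2 -(real_normK (num_real (clamp _ _))).
      rewrite -(real_normK (num_real (X _ _))).
      by rewrite !expr2; apply: ler_pM => //; exact: norm_clamp_le_norm (ltW M0).
    apply: (@le_trans _ _ (SS w / N%:R - S N w / N%:R)); last first.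
      by rewrite lerD2l -normrN ler_norm.
    rewrite -mulrBl ler_pdivlMr// SE -mulr_natr; lra.
  apply: (@le_trans _ _ ((SS w / N%:R + `|S N w / N%:R|) `^ (p / 2))).
    apply: ge0_ler_powR; rewrite ?nnegrE ?(ltW r0)//.
    by rewrite addr_ge0// divr_ge0.
  have h1 : 0 <= SS w / N%:R by rewrite divr_ge0.
  apply: (le_trans (powR_subadd r0 r1 h1 (normr_ge0 _))).
  have -> : (SS w / N%:R) `^ (p / 2) = (N%:R `^ (p / 2))^-1 * SS w `^ (p / 2).
    by rewrite powRM// ?invr_ge0// mulrC -powR_inv1// powRAC powR_inv1// powR_ge0.
  rewrite lerD2l; apply: (le_trans (powR_le_1sqr _ r0 r1)).
  by rewrite lerD2l expr_div_n mulrC.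
have ik : intg P (fun w => kmean mu g w `^ (p / 2)).
  apply: (@le_intg _ _ _ _ _ (fun=> (M ^+ 2) `^ (p / 2))).
  - by apply: (measurableT_comp (@measurable_powR R (p / 2))); case: (bdd_kmean mu bg).
  - exact: intg_cst.
  - move=> w; rewrite ger0_norm ?powR_ge0//; apply: ge0_ler_powR; rewrite ?nnegrE ?(ltW r0) ?sqr_ge0//.
    by have := norm_kmean_le mu w bg g_le; exact: le_trans (ler_norm _).
have i1 : intg P (fun w => (N%:R `^ (p / 2))^-1 * SS w `^ (p / 2)) by exact: intgZ.
have i2 : intg P (fun w => (N%:R ^+ 2)^-1 * S N w ^+ 2) by exact: intgZ.
have i3 : intg P (fun w => 1 + (N%:R ^+ 2)^-1 * S N w ^+ 2).
  by apply: intgD => //; exact: intg_cst.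
apply: (le_trans (le_E ik (intgD i1 i3) pt)).
rewrite ED// ED//; last exact: intg_cst.
rewrite E_cst// EZ// EZ//.
have a1 : (N%:R `^ (p / 2))^-1 * E (fun w => SS w `^ (p / 2)) <= 4 * K.
  by rewrite mulrC ler_pdivrMr// -mulrA.
have a2 : (N%:R ^+ 2)^-1 * E (fun w => S N w ^+ 2) <= 1.
  rewrite mulrC ler_pdivrMr ?exprn_gt0// mul1r; apply: (le_trans (ES N)).
  by rewrite expr2 ler_pM2l.
by lra.
Qed.

End Truncated.
(** Monotone convergence is used twice: under [mu w] the truncated squares increase to [x ^ 2], and
    under [P] the powers of their means increase to [L], whose integral inherits the uniform
    bound. *)
Lemma E_second_moment_powR :
  (\int[P]_w ((\int[mu w]_x (x ^+ 2)%:E) `^ (p / 2)) < +oo)%E.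
Proof.
have r0 : 0 < p / 2 by rewrite divr_gt0// (lt_le_trans ltr01 p1).
pose g n (x : R) := clamp n.+1%:R x * clamp n.+1%:R x.
have bg n : bdd (g n) by apply: bdd_clamp2.
have g0 n x : 0 <= g n x by rewrite /g -expr2 sqr_ge0.
have gS n m x : (n <= m)%N -> g n x <= g m x.
  move=> nm; rewrite /g -!expr2.
  have LM : n.+1%:R <= m.+1%:R :> R by rewrite ler_nat.
  have n0 : 0 <= n.+1%:R :> R by [].
  have := clamp_sqr_le_mul x n0 LM.
  by have := sqr_ge0 (clamp n.+1%:R x - clamp m.+1%:R x); nra.
pose G n w := kmean mu (g n) w.
have G0 n w : 0 <= G n w by exact: E_ge0.
have GE n w : (G n w)%:E = (\int[mu w]_x (g n x)%:E)%E.
  by rewrite EFin_E//; apply: intg_bdd => //; exact: prob_kernel.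
pose u n w := ((G n w) `^ (p / 2))%:E.
have mu_ n : measurable_fun setT (u n).
  apply/measurable_EFinP; apply: (measurableT_comp (@measurable_powR R (p / 2))).
  by case: (bdd_kmean mu (bg n)).
have nd_u w : nondecreasing_seq (u^~ w).
  move=> n m nm; rewrite lee_fin; apply: ge0_ler_powR; rewrite ?nnegrE ?(ltW r0)//.
  by apply: le_kmean => // x; exact: gS.
have u0 n w : (0 <= u n w)%E by rewrite lee_fin powR_ge0.
pose L w := limn (u^~ w).
have uL n w : (u n w <= L w)%E.
  by rewrite /L (cvg_lim _ (ereal_nondecreasing_cvgn (nd_u w)))//; apply: ereal_sup_ubound; exists n.
have intL : (\int[P]_w L w <= (4 * K + 2)%:E)%E.
  rewrite /L monotone_convergence//.
  have ndI : nondecreasing_seq (fun n => \int[P]_w u n w)%E.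
    move=> n m nm; apply: ge0_le_integral.
    - exact: measurableT.
    - by move=> w _; exact: u0.
    - exact: mu_.
    - exact: mu_.
    - by move=> w _; exact: nd_u.
  rewrite (cvg_lim _ (ereal_nondecreasing_cvgn ndI))//.
  apply: ge_ereal_sup => _ [n _ <-]; rewrite -EFin_E.
    by rewrite lee_fin; apply: E_kmean_clamp_powR_le.
  apply: (@le_intg _ _ _ _ _ (fun=> (n.+1%:R ^+ 2) `^ (p / 2))).
  - by have := mu_ n; move/measurable_EFinP.
  - exact: intg_cst.
  - move=> w; rewrite ger0_norm ?powR_ge0//; apply: ge0_ler_powR; rewrite ?nnegrE ?(ltW r0) ?sqr_ge0//.
    apply: (le_trans (ler_norm _)); apply: norm_kmean_le => // x.
    by rewrite normrM expr2 ler_pM// norm_clamp_le.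
apply: le_lt_trans (ltry (4 * K + 2)); apply: le_trans intL.
have L0 w : (0 <= L w)%E by apply: le_trans (u0 0%N w) (uL _ _).
apply: ge0_le_integral => //.
- by move=> w _; exact: poweR_ge0.
- apply: (measurableT_comp (@measurable_poweR R (p / 2))) => //.
  apply: measurable_fun_integral_kernel => [U mU|x|].
  + exact: measurable_kernel.
  + by rewrite lee_fin sqr_ge0.
  + by apply/measurable_EFinP; exact: measurable_funX.
- by apply: (emeasurable_fun_cvg u) => // w _; exact: (ereal_nondecreasing_is_cvgn (nd_u w)).
move=> w _.
(* Comparing with the root of [L w] needs only monotonicity of the power, also at infinite values,
   and no continuity. *)
have m2 : (\int[mu w]_x (x ^+ 2)%:E <= L w `^ (p / 2)^-1)%E.
  have -> : (\int[mu w]_x (x ^+ 2)%:E = limn (fun n => \int[mu w]_x (g n x)%:E))%E.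
    rewrite -monotone_convergence//; last 3 first.
    - by move=> n; apply/measurable_EFinP; case: (bg n).
    - by move=> n x _; rewrite lee_fin.
    - by move=> x _ n m nm; rewrite lee_fin gS.
    apply: eq_integral => x _; apply/esym/cvg_lim => //.
    apply: cvg_near_cst; exists (Num.bound `|x|) => // n /= xn.
    rewrite /g clamp_id ?expr2//.
    apply: ltW; apply: lt_le_trans (archi_boundP (normr_ge0 x)) _.
    by rewrite ler_nat; exact: leq_trans xn _.
  apply: lime_le.
    apply: ereal_nondecreasing_is_cvgn => n m nm; rewrite -!GE lee_fin.
    by apply: le_kmean => // x; exact: gS.
  apply: nearW => n; rewrite -GE.
  have -> : (G n w)%:E = (u n w `^ (p / 2)^-1)%E.
    by rewrite /u poweR_EFin -powRrM mulfV ?gt_eqF// powRr1.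
  apply: gt0_ler_poweR; rewrite ?in_itv/= ?leey ?andbT//.
  by rewrite invr_ge0 ltW.
apply: (@le_trans _ _ ((L w `^ (p / 2)^-1) `^ (p / 2))%E).
  apply: gt0_ler_poweR; rewrite ?in_itv/= ?leey ?andbT ?poweR_ge0 ?(ltW r0)//.
  by apply: integral_ge0 => x _; rewrite lee_fin sqr_ge0.
by rewrite -poweRrM mulVf ?gt_eqF// poweRe1.
Qed.

End Necessity.

(** * Sufficiency: the upper bound *)

Section GeometricBounds.
Context (R : realType).

Lemma sum_half_pow n : \sum_(i < n) (2^-1 : R) ^+ i <= 2.
Proof.
suff -> : \sum_(i < n) (2^-1 : R) ^+ i = 2 - 2 * 2^-1 ^+ n.
  by rewrite gerBl mulr_ge0// exprn_ge0// invr_ge0.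
elim: n => [|n IH]; first by rewrite big_ord0 expr0 mulr1 subrr.
by rewrite big_ord_recr/= IH exprS; lra.
Qed.

(** Because [n <= 2 ^ n]. It adds up the [n] cross terms of a new index, each of size
    [4^-1 ^+ n]. *)
Lemma natr_quarter_pow n : n%:R * (4^-1 : R) ^+ n <= 2^-1 ^+ n.
Proof.
have -> : 4^-1 = 2^-1 * 2^-1 :> R by field.
rewrite exprMn mulrA -[leRHS]mul1r ler_wpM2r ?exprn_ge0 ?invr_ge0//.
rewrite exprVn ler_pdivrMr ?exprn_gt0// mul1r -natrX ler_nat.
by apply: ltnW; exact: ltn_expl.
Qed.

End GeometricBounds.

(** * The weighted second moment estimate *)

Section UpperEstimate.
Context d (T : measurableType d) (R : realType) (P : probability T R).
Context (mu : R.-pker T ~> R) (X : nat -> T -> R) (p : R).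
Local Notation E := (Rintegral P setT).
Hypothesis p1 : 1 <= p.
Hypothesis p2 : p < 2.
Hypothesis mX : forall n, measurable_fun setT (X n).
Hypothesis detX : determining P X.
Hypothesis limX : limit_random_measure P X mu.
Hypothesis normX : forall n, Lnorm P p%:E (EFin \o X n) = 1%E.
Hypothesis uiX : uniformly_integrable P (fun n w => `|X n w| `^ p).
Hypothesis wX : weakly_to_zero P p X.

Let P1 : P setT = 1%E := probability_setT P.
Let p0 : 0 < p := lt_le_trans ltr01 p1.
Let r0 : 0 < p / 2. Proof. by rewrite divr_gt0. Qed.
Let r1 : p / 2 <= 1. Proof. by rewrite ler_pdivrMr// mul1r ltW. Qed.

Let m2 w := (\int[mu w]_x (x ^+ 2)%:E)%E.
Hypothesis intm : (\int[P]_w (m2 w `^ (p / 2)) < +oo)%E.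

(* [fine] sends [+oo] to [0]; [m2] is finite almost everywhere. *)
Let t w := (1 + fine (m2 w)) `^ 2^-1.
Let rho w := t w `^ (p - 2).

Let m2_ge0 w : (0 <= m2 w)%E.
Proof. by apply: integral_ge0 => x _; rewrite lee_fin sqr_ge0. Qed.

Let mm2 : measurable_fun setT m2.
Proof.
apply: measurable_fun_integral_kernel => [U mU|x|].
- exact: measurable_kernel.
- by rewrite lee_fin sqr_ge0.
- by apply/measurable_EFinP; exact: measurable_funX.
Qed.

Let mt : measurable_fun setT t.
Proof.
apply: (measurableT_comp (@measurable_powR R 2^-1)).
by apply: measurable_funD => //; exact: measurableT_comp.
Qed.

Let t1 w : 1 <= t w.
Proof.
have {1}<- : 1 `^ 2^-1 = 1 :> R by rewrite powR1.
apply: ge0_ler_powR; rewrite ?nnegrE ?addr_ge0 ?fine_ge0 ?invr_ge0//.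
by rewrite lerDl fine_ge0.
Qed.

Let tp_ge0 w : 0 <= t w. Proof. exact: powR_ge0. Qed.

Let tn0 w : t w != 0. Proof. by rewrite gt_eqF// (lt_le_trans ltr01). Qed.

Let rho_ge0 w : 0 <= rho w. Proof. exact: powR_ge0. Qed.

Let rho_le1 w : rho w <= 1.
Proof.
by rewrite -(powRr0 (t w)); apply: ler_powR => //; rewrite subr_le0 ltW.
Qed.

Let brho : bdd rho.
Proof.
split; first exact: (measurableT_comp (@measurable_powR R (p - 2))).
by exists 1 => w; rewrite ger0_norm.
Qed.

Let im2 : P.-integrable setT (fun w => m2 w `^ (p / 2))%E.
Proof.
apply/integrableP; split; first exact: (measurableT_comp (@measurable_poweR R (p / 2))).
by under eq_integral do rewrite gee0_abs ?poweR_ge0//.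
Qed.

(** Here [t ^ p = (1 + fine m2) ^ (p / 2)], and subadditivity of the power reduces this to the
    moment hypothesis. *)
Let itp : intg P (fun w => t w `^ p).
Proof.
have i1 : intg P (fun w => fine (m2 w `^ (p / 2))%E).
  apply: (le_integrable measurableT _ _ im2).
    apply/measurable_EFinP; apply: measurableT_comp => //.
    exact: (measurableT_comp (@measurable_poweR R (p / 2))).
  move=> w _ /=; have := poweR_ge0 (m2 w) (p / 2).
  by case: (m2 w `^ (p / 2))%E => [r|//|//] /=; rewrite ?normr0// leey.
apply: (@le_intg _ _ _ _ _ (fun w => 1 + fine (m2 w `^ (p / 2))%E)).
- exact: (measurableT_comp (@measurable_powR R p)).
- by apply: intgD => //; exact: intg_cst.
- move=> w; rewrite ger0_norm ?powR_ge0// /t -powRrM mulrC fine_poweR.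
  have := @powR_subadd R (p / 2) 1 (fine (m2 w)) r0 r1 ler01 (fine_ge0 (m2_ge0 w)).
  by rewrite powR1.
Qed.

(** Where [m2] is finite, hence almost everywhere, the truncated second moment is at most
    [m2 <= t ^ 2], and [t ^ 2 * rho = t ^ p]. The bound is uniform in [M]. *)
Lemma E_weighted_clamp_sqr_le (M : R) : 0 < M ->
  E (fun w => kmean mu (fun x => clamp M x * clamp M x) w * rho w) <=
  E (fun w => t w `^ p).
Proof.
move=> M0; have M0' := ltW M0.
have bg := bdd_clamp2 M0' M0'.
have ik : intg P (fun w => kmean mu (fun x => clamp M x * clamp M x) w * rho w).
  by apply: intg_bdd => //; apply: bddM => //; exact: bdd_kmean.
have G0 w : 0 <= kmean mu (fun x => clamp M x * clamp M x) w.
  by apply: E_ge0 => x; rewrite -expr2 sqr_ge0.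
rewrite -lee_fin EFin_E// EFin_E//; apply: ae_ge0_le_integral => //.
- by move=> w _; rewrite lee_fin mulr_ge0.
- exact: measurable_int ik.
- by move=> w _; rewrite lee_fin powR_ge0.
- exact: measurable_int itp.
apply: filterS (integrable_ae measurableT im2) => w + _ => /(_ I) mfin.
have m2fin : m2 w \is a fin_num.
  move: mfin (m2_ge0 w); case: (m2 w) => [//| |//].
  by rewrite poweRyr ?gt_eqF.
have GM : kmean mu (fun x => clamp M x * clamp M x) w <= fine (m2 w).
  rewrite -lee_fin (fineK m2fin) EFin_E; last by apply: intg_bdd => //; exact: prob_kernel.
  apply: ge0_le_integral => //.
  - by move=> x _; rewrite lee_fin -expr2 sqr_ge0.
  - by apply/measurable_EFinP; case: bg.
  - by apply/measurable_EFinP; exact: measurable_funX.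
  - move=> x _; rewrite lee_fin -expr2 -(real_normK (num_real (clamp _ _))).
    by rewrite -(real_normK (num_real x)) ler_pM// norm_clamp_le_norm.
have t2 : t w ^+ 2 = 1 + fine (m2 w).
  have m0 : 0 <= 1 + fine (m2 w) by rewrite addr_ge0// fine_ge0.
  by rewrite -powR_mulrn// /t -powRrM mulVf// powRr1.
rewrite lee_fin; apply: (@le_trans _ _ (t w ^+ 2 * rho w)).
  by apply: ler_wpM2r => //; rewrite t2; apply: (le_trans GM); rewrite lerDr.
rewrite -powR_mulrn// -powRD; first by rewrite addrC subrK.
by rewrite tn0 implybT.
Qed.

(** The added 1 absorbs the error of stable convergence at a finite index. *)
Let C0 := E (fun w => t w `^ p) + 1.

(** A term is an index together with its own truncation level. The rate [8^-1] beats the weights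
    [4 ^+ i.+1] of the tails, and the rate [4^-1] makes the cross terms summable. The guard
    [0 < z.2] allows [s] to be arbitrary, as the choice principle demands. *)
Definition well_spread (s : seq (nat * R)) (y : nat * R) : Prop :=
  [/\ 0 < y.2,
      E (fun w => `|X y.1 w - clamp y.2 (X y.1 w)| `^ p) <= (8^-1) ^+ (size s).+1,
      E (fun w => clamp y.2 (X y.1 w) * clamp y.2 (X y.1 w) * rho w) <= C0 &
      forall z, z \in s -> 0 < z.2 ->
        `|E (fun w => clamp y.2 (X y.1 w) * (clamp z.2 (X z.1 w) * rho w))|
          <= (4^-1) ^+ (size s)].

(** The level is fixed first, the tail bounds being uniform in [n]. The second moment and the cross
    terms are then reached for large [n], by stable convergence and by weak convergence to zero. *)
Lemma near_well_spread s : exists M, \forall n \near \oo, well_spread s (n, M).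
Proof.
pose e4 : R := (4^-1) ^+ size s; pose e8 : R := (8^-1) ^+ (size s).+1.
have e40 : 0 < e4 by rewrite exprn_gt0// invr_gt0.
have e80 : 0 < e8 by rewrite exprn_gt0// invr_gt0.
(* [D] dominates all earlier levels, hence the earlier truncated variables. A tail of mean at most
   [e4 / 2 / D] then costs [e4 / 2] in a cross term, and the other half is left to weak
   convergence. *)
pose D := 1 + \sum_(z <- s) `|z.2|.
have D1 : 1 <= D by rewrite lerDl sumr_ge0.
have D0 : 0 < D by exact: lt_le_trans D1.
have eD : 0 < e4 / 2 / D by rewrite !divr_gt0.
pose e := Num.min e8 (e4 / 2 / D).
have e0 : 0 < e by rewrite lt_min e80.
have [M M1 tail] := clamp_tail p1 mX normX uiX e0.
have M0 : 0 < M by exact: lt_le_trans M1.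
exists M.
have irho : intg P rho by exact: intg_bdd.
have sq : \forall n \near \oo,
    E (fun w => clamp M (X n w) * clamp M (X n w) * rho w) <= C0.
  have /cvgrPdist_le/(_ 1 ltr01) := stable_clamp2 mX detX limX M0 (lexx M) irho.
  apply: filterS => n; have := E_weighted_clamp_sqr_le M0.
  by rewrite /C0 ler_norml => h /andP[? ?]; lra.
have cross : \forall n \near \oo, forall z, z \in s -> 0 < z.2 ->
    `|E (fun w => clamp M (X n w) * (clamp z.2 (X z.1 w) * rho w))| <= e4.
  apply: near_in_seq => z zs; have [z0|z0] := leP z.2 0.
    by apply: nearW.
  pose W w := clamp z.2 (X z.1 w) * rho w.
  have bW : bdd W by apply: bddM => //; exact: bddX_clamp mX _ _ (ltW z0).
  have Wz w : `|W w| <= z.2.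
    rewrite normrM -[leRHS]mulr1; apply: ler_pM => //; first exact: norm_clamp_le (ltW z0).
    by rewrite ger0_norm.
  have e42 : 0 < e4 / 2 by rewrite divr_gt0.
  have /cvgrPdist_le/(_ _ e42) := weak_null p1 wX bW.
  apply: filterS => n; rewrite sub0r normrN => h1 _.
  have iXn := intgX p1 mX normX n.
  have iXW : intg P (fun w => X n w * W w) by exact: intgM_bdd.
  have iT := intgX_clamp p1 mX normX n (ltW M0).
  have iTW : intg P (fun w => (X n w - clamp M (X n w)) * W w) by exact: intgM_bdd.
  rewrite (@eqE _ _ _ _ _ (fun w => X n w * W w - (X n w - clamp M (X n w)) * W w)).
    rewrite EB//; apply: (le_trans (ler_normB _ _)).
    have h2 : `|E (fun w => (X n w - clamp M (X n w)) * W w)| <= e4 / 2.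
      apply: (le_trans (norm_E iTW)).
      apply: (@le_trans _ _ (E (fun w => z.2 * `|X n w - clamp M (X n w)|))).
        apply: le_E => [||w]; first exact: intg_norm.
          by apply: intgZ; exact: intg_norm.
        by rewrite normrM mulrC ler_wpM2r.
      rewrite EZ; last exact: intg_norm.
      have [_ h] := tail M n (lexx M).
      apply: (@le_trans _ _ (D * (e4 / 2 / D))); last by rewrite mulrC divfK ?gt_eqF.
      apply: ler_pM; [exact: ltW|exact: E_ge0| |].
        apply: (@le_trans _ _ `|z.2|); first exact: ler_norm.
        by rewrite /D (big_rem z)//= addrCA lerDl addr_ge0// sumr_ge0.
      by apply: (le_trans h); rewrite ge_min lexx orbT.
    by lra.
  by move=> w; rewrite /W; ring.
near=> n; split => //=.
- have [h _] := tail M n (lexx M); apply: (le_trans h).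
  by rewrite ge_min lexx.
- by near: n.
- by near: n.
Unshelve. all: by end_near. Qed.

(** Each variable splits into its truncation [Y] and its tail [Z]. The sum of truncations is
    controlled by its second moment under [rho], the sum of tails by their geometric decay. *)
Lemma upper_estimate (f : nat -> nat * R) :
  (forall i, well_spread (mkseq f i) (f i)) ->
  exists2 C : R, 0 < C & forall m (a : nat -> R), \sum_(i < m) a i ^+ 2 <= 1 ->
    intg P (fun w => `|\sum_(i < m) a i * X (f i).1 w| `^ p) /\
    E (fun w => `|\sum_(i < m) a i * X (f i).1 w| `^ p) <= C.
Proof.
move=> fP.
pose Y i w := clamp (f i).2 (X (f i).1 w).
pose Z i w := X (f i).1 w - Y i w.
have M0 i : 0 < (f i).2 by case: (fP i).
have bY i : bdd (Y i) by exact: bddX_clamp mX _ _ (ltW (M0 i)).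
have C00 : 0 <= C0.
  by rewrite addr_ge0// E_ge0// => w; exact: powR_ge0.
(* [C0 + 4] bounds the weighted second moment, the integral of [t ^ p] comes from
   [powR_weighted_le], and 1 bounds the tails. *)
exists (4 * (C0 + 4 + E (fun w => t w `^ p) + 1)).
  by have := E_ge0 P (fun w => powR_ge0 (t w) p); lra.
move=> m a a1.
have an i : (i < m)%N -> `|a i| <= 1.
  move=> im; rewrite -(@expr_le1 _ 2)// real_normK ?num_real//.
  apply: le_trans a1; rewrite (bigD1 (Ordinal im))//= lerDl sumr_ge0// => j _.
  exact: sqr_ge0.
pose S k w := \sum_(i < k) a i * Y i w.
have bS k : bdd (S k).
  elim: k => [|k IH]; rewrite /S.
    by under [X in bdd X]eq_fun do rewrite big_ord0; exact: bdd_cst.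
  by under [X in bdd X]eq_fun do rewrite big_ord_recr/=; apply: bddD => //; exact: bddZ.
have iS k : intg P (fun w => S k w ^+ 2 * rho w).
  by apply: intg_bdd => //; apply: bddM => //; exact: bdd_sqr.
(* Almost orthogonality under [rho]: the new term adds at most [C0 * a k ^ 2] on the diagonal and
   [2 * 2^-1 ^+ k] from its cross terms. *)
have ES k : (k <= m)%N -> E (fun w => S k w ^+ 2 * rho w) <=
    C0 * (\sum_(i < k) a i ^+ 2) + 2 * \sum_(i < k) (2^-1) ^+ i.
  elim: k => [_|k IH km].
    rewrite (@eqE _ _ _ _ _ (fun=> 0)) ?E_cst ?big_ord0 ?mulr0 ?addr0// => w.
    by rewrite /S big_ord0 expr0n mul0r.
  have {IH} := IH (ltnW km).
  have iYS : intg P (fun w => Y k w * (S k w * rho w)).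
    by apply: intg_bdd => //; apply: bddM => //; exact: bddM.
  have iYY : intg P (fun w => Y k w * Y k w * rho w).
    by apply: intg_bdd => //; apply: bddM => //; exact: bddM.
  have i2 := intgZ (2 * a k) iYS; have i3 := intgZ (a k ^+ 2) iYY.
  have -> : E (fun w => S k.+1 w ^+ 2 * rho w) = E (fun w => S k w ^+ 2 * rho w) +
      2 * a k * E (fun w => Y k w * (S k w * rho w)) +
      a k ^+ 2 * E (fun w => Y k w * Y k w * rho w).
    rewrite -EZ// -EZ// -ED// -ED//; last exact: intgD.
    by apply: eqE => w; rewrite {1}/S big_ord_recr/= -/(S k w); ring.
  have [_ _ EYY EYj] := fP k.
  have EYS : `|E (fun w => Y k w * (S k w * rho w))| <= (2^-1) ^+ k.
    have iYj i : intg P (fun w => Y k w * (Y i w * rho w)).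
      by apply: intg_bdd => //; apply: bddM => //; exact: bddM.
    have -> : E (fun w => Y k w * (S k w * rho w)) =
        \sum_(i < k) a i * E (fun w => Y k w * (Y i w * rho w)).
      under [RHS]eq_bigr do rewrite -EZ//.
      rewrite -(E_sum (f := fun i w => a i * (Y k w * (Y i w * rho w)))).
        apply: eqE => w; rewrite /S mulr_suml mulr_sumr; apply: eq_bigr => i _.
        by ring.
      by move=> i _; exact: intgZ.
    apply: (le_trans (ler_norm_sum _ _ _)).
    apply: (@le_trans _ _ (\sum_(i < k) (4^-1) ^+ k)).
      apply: ler_sum => i _; rewrite normrM -[leRHS]mul1r; apply: ler_pM => //.
        by apply: an; exact: ltn_trans km.
      have := EYj (f i); rewrite size_mkseq; apply => //.
      by apply/mapP; exists (i : nat); rewrite // mem_iota/=.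
    by rewrite sumr_const card_ord -[_ *+ _]mulr_natl; exact: natr_quarter_pow.
  have ak : `|a k| <= 1 by exact: an.
  have : a k * E (fun w => Y k w * (S k w * rho w)) <= (2^-1) ^+ k.
    apply: (le_trans (ler_norm _)); rewrite normrM -[leRHS]mul1r.
    by apply: ler_pM.
  have : a k ^+ 2 * E (fun w => Y k w * Y k w * rho w) <= C0 * a k ^+ 2.
    by rewrite mulrC ler_wpM2r ?sqr_ge0.
  by rewrite !big_ord_recr/=; lra.
have ip i : intg P (fun w => `|Z i w| `^ p).
  exact: (intg_powR_clamp p1 mX normX (f i).1 (ltW (M0 i))).
pose tailsum w := \sum_(i < m) 4 ^+ i.+1 * `|Z i w| `^ p.
have itail : intg P tailsum.
  by apply: (intg_sum (f := fun i w => 4 ^+ i.+1 * `|Z i w| `^ p)) => i _; exact: intgZ.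
have Etail : E tailsum <= 1.
  rewrite (E_sum (f := fun i w => 4 ^+ i.+1 * `|Z i w| `^ p)) => [|i _]; last exact: intgZ.
  apply: (@le_trans _ _ (\sum_(i < m) 2^-1 * (2^-1) ^+ i)).
    apply: ler_sum => i _; rewrite EZ//.
    have [_ + _ _] := fP i; rewrite size_mkseq => h.
    apply: (@le_trans _ _ (4 ^+ i.+1 * (8^-1) ^+ i.+1)).
      by apply: ler_wpM2l => //; rewrite exprn_ge0.
    rewrite -exprMn -exprS le_eqVlt; apply/orP; left; apply/eqP; congr (_ ^+ _).
    by field.
  by rewrite -mulr_sumr; have := sum_half_pow R m; lra.
pose bound w := 4 * (S m w ^+ 2 * rho w + t w `^ p + tailsum w).
have i12 : intg P (fun w => S m w ^+ 2 * rho w + t w `^ p) by exact: intgD.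
have ibound : intg P bound by apply: intgZ; exact: intgD.
have pt w : `|\sum_(i < m) a i * X (f i).1 w| `^ p <= bound w.
  have -> : \sum_(i < m) a i * X (f i).1 w = S m w + \sum_(i < m) a i * Z i w.
    by rewrite /S -big_split/=; apply: eq_bigr => i _; rewrite /Z; ring.
  apply: (le_trans (powR_add_le4 _ _ p1 (ltW p2))).
  rewrite ler_pM2l//; apply: lerD.
    exact: powR_weighted_le (ltW p0) (ltW p2) (t1 w).
  apply: (le_trans (powR_sum_le4 (fun i => a i * Z i w) m p1 (ltW p2))).
  apply: ler_sum => i _; apply: ler_wpM2l; first exact: exprn_ge0.
  apply: ge0_ler_powR; rewrite ?nnegrE ?(ltW p0)//.
  by rewrite normrM -[leRHS]mul1r ler_wpM2r// an.
have ires : intg P (fun w => `|\sum_(i < m) a i * X (f i).1 w| `^ p).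
  apply: (@le_intg _ _ _ _ _ bound) => //.
    apply: measurable_norm_powR.
    apply: (@measurable_sum _ _ _ setT _ _ (fun (i : 'I_m) w => a i * X (f i).1 w)) => i.
    exact: measurable_funM.
  by move=> w; rewrite ger0_norm ?powR_ge0.
split => //; apply: (le_trans (le_E ires ibound pt)).
rewrite EZ; last exact: intgD.
rewrite ED// ED// ler_pM2l//.
have := ES m (leqnn m); have := sum_half_pow R m.
have : C0 * (\sum_(i < m) a i ^+ 2) <= C0 by rewrite -[leRHS]mulr1 ler_wpM2l.
by lra.
Qed.

End UpperEstimate.

(** * Sufficiency: the lower bound *)

Section RieszProduct.
Context d (T : measurableType d) (R : realType) (P : probability T R).
Local Notation E := (Rintegral P setT).
Implicit Types (z : nat -> T -> R) (a : nat -> R).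

Let P1 : P setT = 1%E := probability_setT P.

(* Real and imaginary parts of [\prod_(j < k) (1 + 'i * a j * z j)]. *)
Fixpoint riesz a z k (w : T) : R * R :=
  if k is k'.+1 then
    let AB := riesz a z k' w in
    (AB.1 - a k' * (z k' w * AB.2), AB.2 + a k' * (z k' w * AB.1))
  else (1, 0).

(** All products of distinct [z j] with [j < k]. Both parts of the Riesz product are combinations of
    them with coefficients built from [a]; testing on this finite list gives bounds uniform in
    [a]. *)
Fixpoint monomials z k : seq (T -> R) :=
  if k is k'.+1 then
    monomials z k' ++ [seq (fun w => z k' w * u w) | u <- monomials z k']
  else [:: fun=> 1].

Lemma eq_monomials z z' k : (forall j, (j < k)%N -> z j = z' j) ->
  monomials z k = monomials z' k.
Proof.
elim: k => //= k IH zz'; rewrite IH => [|j /ltnW]; last exact: zz'.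
by rewrite zz'.
Qed.

Lemma bdd_monomials z k u : (forall j, bdd (z j)) -> u \in monomials z k -> bdd u.
Proof.
move=> bz; elim: k u => [u|k IH u] /=.
  by rewrite inE => /eqP ->; exact: bdd_cst.
by rewrite mem_cat => /orP[/IH//|/mapP[v /IH bv ->]]; exact: bddM.
Qed.

Lemma bdd_riesz a z k : (forall j, bdd (z j)) ->
  bdd (fun w => (riesz a z k w).1) /\ bdd (fun w => (riesz a z k w).2).
Proof.
move=> bz; elim: k => [|k [IH1 IH2]] /=; first by split; exact: bdd_cst.
by split; [apply: bddB|apply: bddD] => //; apply: bddZ; exact: bddM.
Qed.

(** The squared modulus of each factor is [1 + a j ^ 2 * z j ^ 2], which is at most
    [expR (b ^ 2 * a j ^ 2)]. *)
Lemma riesz_sqr_le a z (b : R) k w : (forall j, `|z j w| <= b) ->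
  (riesz a z k w).1 ^+ 2 + (riesz a z k w).2 ^+ 2 <=
  expR (b ^+ 2 * \sum_(j < k) a j ^+ 2).
Proof.
move=> zb; elim: k => [|k IH] /=.
  by rewrite big_ord0 mulr0 expR0 expr1n expr0n addr0.
set A := (riesz a z k w).1 in IH *; set B := (riesz a z k w).2 in IH *.
rewrite big_ord_recr/= mulrDr expRD.
have -> : (A - a k * (z k w * B)) ^+ 2 + (B + a k * (z k w * A)) ^+ 2 =
    (A ^+ 2 + B ^+ 2) * (1 + z k w ^+ 2 * a k ^+ 2) by ring.
apply: ler_pM; [by rewrite addr_ge0 ?sqr_ge0| |exact: IH|].
  by rewrite addr_ge0// mulr_ge0 ?sqr_ge0.
apply: (@le_trans _ _ (1 + b ^+ 2 * a k ^+ 2)); last exact: expR_ge1Dx.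
rewrite lerD2l ler_wpM2r ?sqr_ge0//.
by rewrite -(real_normK (num_real (z k w))) !expr2; apply: ler_pM.
Qed.

Lemma norm_riesz_le a z (b : R) k w : (forall j, `|z j w| <= b) ->
  \sum_(j < k) a j ^+ 2 <= 1 ->
  `|(riesz a z k w).1| <= expR (b ^+ 2) /\ `|(riesz a z k w).2| <= expR (b ^+ 2).
Proof.
move=> zb a1; have := riesz_sqr_le a k zb.
set A := (riesz a z k w).1; set B := (riesz a z k w).2; set e := expR (b ^+ 2).
have e1 : 1 <= e by rewrite /e -expR0 ler_expR sqr_ge0.
have : expR (b ^+ 2 * \sum_(j < k) a j ^+ 2) <= e.
  by rewrite ler_expR -[leRHS]mulr1 ler_wpM2l ?sqr_ge0.
move=> h1 h2; have h : A ^+ 2 + B ^+ 2 <= e by exact: le_trans h2 h1.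
(* Since [e >= 1], no square root of the bound is needed. *)
have key x : x ^+ 2 <= e -> `|x| <= e.
  rewrite -(real_normK (num_real x)) => xe; rewrite leNgt; apply/negP => ex.
  by have := normr_ge0 x; nra.
by split; apply: key; have := sqr_ge0 A; have := sqr_ge0 B; lra.
Qed.

(** The factor [2 ^+ k] counts the monomials, whose coefficients are at most 1 in absolute value.
    The induction splits off the last factor by testing [U * z k] as well as [U]. *)
Lemma riesz_test_le a z k (U : T -> R) (e : R) :
  (forall j, bdd (z j)) -> (forall j, (j < k)%N -> `|a j| <= 1) -> intg P U ->
  (forall u, u \in monomials z k -> `|E (fun w => U w * u w)| <= e) ->
  `|E (fun w => U w * (riesz a z k w).1)| <= 2 ^+ k * e /\
  `|E (fun w => U w * (riesz a z k w).2)| <= 2 ^+ k * e.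
Proof.
move=> bz; elim: k U => [|k IH] U a1 iU H /=.
  rewrite expr0 mul1r; have := H _ (mem_head _ _) => H1; split=> //.
  rewrite (@eqE _ _ _ _ _ (fun=> 0)) ?E_cst// => [|w]; last by rewrite mulr0.
  by rewrite normr0 (le_trans _ H1).
have a1' j : (j < k)%N -> `|a j| <= 1 by move=> /ltnW; exact: a1.
have iUz : intg P (fun w => U w * z k w) by exact: intgM_bdd.
have [|A1 B1] := IH U a1' iU.
  by move=> u uk; apply: H; rewrite /= mem_cat uk.
have [|A2 B2] := IH (fun w => U w * z k w) a1' iUz.
  move=> u uk; rewrite (@eqE _ _ _ _ _ (fun w => U w * (z k w * u w))).
    by apply: H; rewrite /= mem_cat; apply/orP; right; apply/mapP; exists u.
  by move=> w; rewrite mulrA.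
have [bA bB] := bdd_riesz a k bz.
have iUA : intg P (fun w => U w * (riesz a z k w).1) by exact: intgM_bdd.
have iUB : intg P (fun w => U w * (riesz a z k w).2) by exact: intgM_bdd.
have iUzA : intg P (fun w => U w * z k w * (riesz a z k w).1) by exact: intgM_bdd.
have iUzB : intg P (fun w => U w * z k w * (riesz a z k w).2) by exact: intgM_bdd.
have ak : `|a k| <= 1 by exact: a1.
have key (x y : R) : `|x| <= 2 ^+ k * e -> `|y| <= 2 ^+ k * e ->
    `|x + a k * y| <= 2 ^+ k.+1 * e.
  move=> xe ye; rewrite exprS; apply: (le_trans (ler_normD _ _)); rewrite normrM.
  by have := normr_ge0 y; have := normr_ge0 (a k); nra.
split.
- rewrite (@eqE _ _ _ _ _ (fun w => U w * (riesz a z k w).1 -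
    a k * (U w * z k w * (riesz a z k w).2))) => [|w]; last by ring.
  rewrite EB//; last exact: intgZ.
  by rewrite EZ// -mulrN; apply: key; rewrite ?normrN.
- rewrite (@eqE _ _ _ _ _ (fun w => U w * (riesz a z k w).2 +
    a k * (U w * z k w * (riesz a z k w).1))) => [|w]; last by ring.
  rewrite ED//; last exact: intgZ.
  by rewrite EZ//; apply: key.
Qed.

End RieszProduct.

(** * Testing sums against the Riesz product *)

Section LowerEstimate.
Context d (T : measurableType d) (R : realType) (P : probability T R).
Context (mu : R.-pker T ~> R) (X : nat -> T -> R) (p : R).
Local Notation E := (Rintegral P setT).
Hypothesis p1 : 1 <= p.
Hypothesis mX : forall n, measurable_fun setT (X n).
Hypothesis detX : determining P X.
Hypothesis limX : limit_random_measure P X mu.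
Hypothesis normX : forall n, Lnorm P p%:E (EFin \o X n) = 1%E.
Hypothesis wX : weakly_to_zero P p X.

Let P1 : P setT = 1%E := probability_setT P.
Let iX n : intg P (X n) := intgX p1 mX normX n.

Section Levels.
Context (L M : R).
Hypothesis L0 : 0 < L.
Hypothesis LM : L <= M.
Context (eta : R).
Hypothesis eta0 : 0 < eta.
Hypothesis eta_le : 512 * eta <= 1.

Let M0 : 0 < M := lt_le_trans L0 LM.
Let bcl n : bdd (fun w => clamp L (X n w)) := bddX_clamp mX n (ltW L0).
Let bcm n : bdd (fun w => clamp M (X n w)) := bddX_clamp mX n (ltW M0).

(** Subtracting the limiting conditional mean makes this sequence converge stably to zero in mean
    against every integrable weight, which weak convergence of [X] does not give for its
    truncations. *)
Definition ctrunc n w := clamp L (X n w) - kmean mu (clamp L) w.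
Let Z := ctrunc.

Let bG : bdd (kmean mu (clamp L)) := bdd_kmean mu (bdd_clamp (ltW L0)).

Let G_le w : `|kmean mu (clamp L) w| <= L.
Proof.
by apply: norm_kmean_le => [|x]; [exact: bdd_clamp (ltW L0)|exact: norm_clamp_le (ltW L0)].
Qed.

Let bZ n : bdd (Z n). Proof. exact: bddB. Qed.

Let Z_le n w : `|Z n w| <= 2 * L.
Proof.
apply: (le_trans (ler_normB _ _)).
have h1 := norm_clamp_le (X n w) (ltW L0).
have h2 := G_le w.
by rewrite mulr_natl mulr2n; apply: lerD.
Qed.

(** The conditional covariance, under [mu w], of the truncations at levels [M] and [L]; its
    expectation is the [v] of the overview. *)
Definition cov_limit w := kmean mu (fun x => clamp M x * clamp L x) w -
  kmean mu (clamp M) w * kmean mu (clamp L) w.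
Let V := cov_limit.

Let bV : bdd V.
Proof.
have b1 := bdd_kmean mu (bdd_clamp2 (ltW L0) (ltW M0)).
exact: bddB b1 (bddM (bdd_kmean mu (bdd_clamp (ltW M0))) bG).
Qed.

Lemma ctrunc_null (W : T -> R) (e : R) : intg P W -> 0 < e ->
  \forall n \near \oo, `|E (fun w => Z n w * W w)| <= e.
Proof.
move=> iW e0.
have /cvgrPdist_le/(_ e e0) := stable_clamp mX detX limX L0 iW.
apply: filterS => n; rewrite distrC -EB; last 2 first.
- exact: intgMl_bdd.
- exact: intgMl_bdd.
by congr (_ <= _); congr (`|_|); apply: eqE => w; rewrite -mulrBl.
Qed.

(** The product expands into two terms that converge stably, the second with the weight
    [kmean mu (clamp L) * W]. *)
Lemma cov_limitP (W : T -> R) (e : R) : bdd W -> 0 < e ->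
  \forall n \near \oo,
    `|E (fun w => (clamp M (X n w) * Z n w - V w) * W w)| <= e.
Proof.
move=> bW e0; have iW := intg_bdd P1 bW.
have e2 : 0 < e / 2 by rewrite divr_gt0.
have iGW : intg P (fun w => kmean mu (clamp L) w * W w) by exact: intgMl_bdd.
have /cvgrPdist_le/(_ _ e2) h1 := stable_clamp2 mX detX limX L0 LM iW.
have /cvgrPdist_le/(_ _ e2) h2 := stable_clamp mX detX limX M0 iGW.
have bk := bdd_kmean mu (bdd_clamp2 (ltW L0) (ltW M0)).
have bkM := bdd_kmean mu (bdd_clamp (ltW M0)).
near=> n.
have i1 : intg P (fun w => kmean mu (fun x => clamp M x * clamp L x) w * W w).
  exact: intgMl_bdd.
have i2 : intg P (fun w => clamp M (X n w) * clamp L (X n w) * W w).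
  by apply: intgMl_bdd => //; exact: bddM.
have i3 : intg P (fun w => kmean mu (clamp M) w * (kmean mu (clamp L) w * W w)).
  exact: intgMl_bdd.
have i4 : intg P (fun w => clamp M (X n w) * (kmean mu (clamp L) w * W w)).
  exact: intgMl_bdd.
rewrite (@eqE _ _ _ _ _ (fun w =>
  (kmean mu (clamp M) w * (kmean mu (clamp L) w * W w) -
    clamp M (X n w) * (kmean mu (clamp L) w * W w)) -
  (kmean mu (fun x => clamp M x * clamp L x) w * W w -
    clamp M (X n w) * clamp L (X n w) * W w))); last first.
  by move=> w; rewrite /V /Z /cov_limit /ctrunc; ring.
rewrite EB; [|exact: intgB|exact: intgB].
rewrite EB// EB//; apply: (le_trans (ler_normB _ _)).
rewrite (splitr e); apply: lerD.
  by near: n.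
by near: n.
Unshelve. all: by end_near. Qed.

(** The mixed second moment is at least [1 / 4]. The errors are [1 / 32] from the covariance limit,
    [1 / 32] from weak convergence of [X] against [kmean mu (clamp L)], and [1 / 64] from the
    truncation tail. *)
Lemma cov_limit_lower :
  (forall n, 1 / 4 <= E (fun w => clamp L (X n w) ^+ 2)) ->
  (forall n, E (fun w => `|X n w - clamp M (X n w)|) <= (64 * L)^-1) ->
  1 / 8 <= E V.
Proof.
move=> lowL tailM.
have e0 : 0 < 32^-1 :> R by rewrite invr_gt0.
have h1 := cov_limitP (bdd_cst T (1 : R)) e0.
have h2 := weak_null p1 wX bG.
move/cvgrPdist_le : h2 => /(_ _ e0) h2.
have : \forall n \near \oo, 1 / 8 <= E V.
  near=> n.
  have n1 : `|E (fun w => (clamp M (X n w) * Z n w - V w) * 1)| <= 32^-1 by near: n.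
  have n2 : `|0 - E (fun w => X n w * kmean mu (clamp L) w)| <= 32^-1 by near: n.
  have iV : intg P V by exact: intg_bdd.
  have icZ : intg P (fun w => clamp M (X n w) * Z n w).
    by apply: intg_bdd => //; exact: bddM.
  have icc : intg P (fun w => clamp M (X n w) * clamp L (X n w)).
    by apply: intg_bdd => //; exact: bddM.
  have iXG : intg P (fun w => X n w * kmean mu (clamp L) w) by exact: intgM_bdd.
  have iT := intgX_clamp p1 mX normX n (ltW M0).
  have iTG : intg P (fun w => (X n w - clamp M (X n w)) * kmean mu (clamp L) w).
    exact: intgM_bdd.
  have e1 : E (fun w => (clamp M (X n w) * Z n w - V w) * 1) =
      E (fun w => clamp M (X n w) * Z n w) - E V.
    by rewrite -EB//; apply: eqE => w; rewrite mulr1.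
  have e2 : E (fun w => clamp M (X n w) * Z n w) =
      E (fun w => clamp M (X n w) * clamp L (X n w)) -
      (E (fun w => X n w * kmean mu (clamp L) w) -
       E (fun w => (X n w - clamp M (X n w)) * kmean mu (clamp L) w)).
    rewrite -EB// -EB//; last exact: intgB.
    by apply: eqE => w; rewrite /Z /ctrunc; ring.
  have e3 : 1 / 4 <= E (fun w => clamp M (X n w) * clamp L (X n w)).
    apply: (le_trans (lowL n)); apply: le_E => //.
      by apply: intg_bdd => //; exact: bdd_sqr.
    by move=> w; exact: clamp_sqr_le_mul (ltW L0) LM.
  have e4 : `|E (fun w => (X n w - clamp M (X n w)) * kmean mu (clamp L) w)| <= 64^-1.
    apply: (le_trans (norm_E iTG)).
    apply: (@le_trans _ _ (E (fun w => L * `|X n w - clamp M (X n w)|))).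
      apply: le_E => [||w]; [exact: intg_norm|by apply: intgZ; exact: intg_norm|].
      rewrite normrM mulrC; exact: ler_wpM2r.
    rewrite EZ; last exact: intg_norm.
    apply: (@le_trans _ _ (L * (64 * L)^-1)); first by rewrite ler_wpM2l// ltW.
    by rewrite invfM mulrCA divff ?gt_eqF// mulr1.
  move: n1; rewrite e1 e2 => n1.
  move: n1 n2 e4; rewrite !ler_norml => /andP[? ?] /andP[? ?] /andP[? ?].
  by lra.
by case=> n _ /(_ n (leqnn n)).
Unshelve. all: by end_near. Qed.

(** These are the error terms met when the Riesz product gains a factor. With [k = size s], the rate
    [8 ^ - k] becomes [4 ^ - k] after summing [2 ^ k] monomials, and [2 ^ - k] after also summing
    over [k] earlier indices. *)
Definition riesz_test (s : seq nat) (n : nat) : Prop :=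
  let e := eta * (8^-1) ^+ size s in
  forall u, u \in monomials (fun i => Z (nth 0%N s i)) (size s) ->
  [/\ `|E (fun w => X n w * u w)| <= e,
      forall i, i \in s -> `|E (fun w => X i w * Z n w * u w)| <= e,
      `|E (fun w => (clamp M (X n w) * Z n w - V w) * u w)| <= e &
      `|E (fun w => V w * Z n w * u w)| <= e].

Lemma near_riesz_test s : \forall n \near \oo, riesz_test s n.
Proof.
rewrite /riesz_test; set e : R := _ * _.
have e0 : 0 < e by apply: mulr_gt0 => //; rewrite exprn_gt0 ?invr_gt0.
apply: near_in_seq => u us.
have bu : bdd u by apply: bdd_monomials us => j; exact: bZ.
have h1 := weak_null p1 wX bu; move/cvgrPdist_le : h1 => /(_ _ e0) h1.
have h3 := cov_limitP bu e0.
have h2 : \forall n \near \oo, forall i, i \in s -> `|E (fun w => X i w * Z n w * u w)| <= e.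
  apply: near_in_seq => i _.
  have iXu : intg P (fun w => X i w * u w) by exact: intgM_bdd.
  apply: filterS (ctrunc_null iXu e0) => n.
  by rewrite (@eqE _ _ _ _ _ (fun w => X i w * Z n w * u w)) => [//|w]; ring.
have iVu : intg P (fun w => V w * u w) by apply: intg_bdd => //; exact: bddM.
have h4 := ctrunc_null iVu e0.
near=> n; split.
- have : `|0 - E (fun w => X n w * u w)| <= e by near: n.
  by rewrite sub0r normrN.
- by near: n.
- by near: n.
- have : `|E (fun w => Z n w * (V w * u w))| <= e by near: n.
  by rewrite (@eqE _ _ _ _ _ (fun w => V w * Z n w * u w)) => [//|w]; ring.
Unshelve. all: by end_near. Qed.

(** The imaginary part [B m] is bounded by [CB], so the first absolute moment of [S m] is at least
    [E (S m * B m) / CB]; this expectation is built up one factor at a time. *)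
Lemma lower_estimate (f : nat -> nat) :
  (forall n, 1 / 4 <= E (fun w => clamp L (X n w) ^+ 2)) ->
  (forall n, E (fun w => `|X n w - clamp M (X n w)|) <= (64 * L)^-1) ->
  (forall n, E (fun w => `|X n w - clamp M (X n w)|) <=
     (64 * L * expR ((2 * L) ^+ 2))^-1) ->
  (forall k, riesz_test (mkseq f k) (f k)) ->
  forall m (a : nat -> R), \sum_(i < m) a i ^+ 2 = 1 ->
    (16 * expR ((2 * L) ^+ 2))^-1 <= E (fun w => `|\sum_(i < m) a i * X (f i) w|).
Proof.
move=> lowL tailM tailM' fP m a am.
set CB := expR _ in tailM' *.
have CB0 : 0 < CB by exact: expR_gt0.
pose z k := Z (f k).
have bz k : bdd (z k) by exact: bZ.
have zb k w : `|z k w| <= 2 * L by exact: Z_le.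
pose e k : R := eta * (4^-1) ^+ k.
have mono k : monomials (fun i => Z (nth 0%N (mkseq f k) i)) k = monomials z k.
  by apply: eq_monomials => j jk; rewrite nth_mkseq.
have eE k : 2 ^+ k * (eta * (8^-1) ^+ k) = e k.
  by rewrite mulrCA -exprMn /e; congr (_ * _ ^+ _); field.
have an j : (j < m)%N -> `|a j| <= 1.
  move=> jm; rewrite -(@expr_le1 _ 2)// real_normK ?num_real// -am.
  rewrite (bigD1 (Ordinal jm))//= lerDl sumr_ge0// => i _.
  exact: sqr_ge0.
have aS k : (k <= m)%N -> \sum_(j < k) a j ^+ 2 <= 1.
  move=> km; rewrite -am !(big_ord_widen _ (fun j => a j ^+ 2) km).
  rewrite [leRHS](bigID (fun i : 'I_m => (i < k)%N))/= lerDl sumr_ge0// => i _.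
  exact: sqr_ge0.
pose A k w := (riesz a z k w).1; pose B k w := (riesz a z k w).2.
have bA k : bdd (A k) by case: (bdd_riesz a k bz).
have bB k : bdd (B k) by case: (bdd_riesz a k bz).
have AB_le k w : (k <= m)%N -> `|A k w| <= CB /\ `|B k w| <= CB.
  by move=> km; apply: norm_riesz_le; [move=> j; exact: zb|exact: aS].
have test k (U : T -> R) : (k <= m)%N -> intg P U ->
    (forall u, u \in monomials z k ->
      `|E (fun w => U w * u w)| <= eta * (8^-1) ^+ k) ->
    `|E (fun w => U w * A k w)| <= e k /\ `|E (fun w => U w * B k w)| <= e k.
  move=> km iU H; rewrite -eE; apply: riesz_test_le => // j jk.
  by apply: an; exact: leq_trans jk km.
have fPk k u : u \in monomials z k -> let e' := eta * (8^-1) ^+ k in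
    [/\ `|E (fun w => X (f k) w * u w)| <= e',
        forall i, (i < k)%N -> `|E (fun w => X (f i) w * z k w * u w)| <= e',
        `|E (fun w => (clamp M (X (f k) w) * z k w - V w) * u w)| <= e' &
        `|E (fun w => V w * z k w * u w)| <= e'].
  move=> uk; have := fP k; rewrite /riesz_test size_mkseq mono => /(_ u uk)[h1 h2 h3 h4].
  split=> // i ik; apply: h2.
  by apply/mapP; exists i; rewrite // mem_iota.
have e0 k : 0 <= e k by apply: mulr_ge0; [exact: ltW|rewrite exprn_ge0 ?invr_ge0].
have e_le k : e k <= eta * (2^-1) ^+ k.
  apply: ler_wpM2l; first exact: ltW.
  apply: lerXn2r; rewrite ?nnegrE ?invr_ge0//.
  by rewrite lef_pV2 ?posrE// ler_nat.
have ke_le k : k%:R * e k <= eta * (2^-1) ^+ k.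
  by rewrite mulrCA ler_wpM2l ?(ltW eta0)//; exact: natr_quarter_pow.
have iV : intg P V by exact: intg_bdd.
have iVz k : intg P (fun w => V w * z k w) by exact: intgM_bdd.
(* The real part can be replaced by 1 against [V]: passing from [A k] to [A k.+1] subtracts
   [a k * z k * B k], which is nearly orthogonal to [V]. *)
have EVA k : (k <= m)%N -> E V - eta * \sum_(i < k) (2^-1) ^+ i <= E (fun w => V w * A k w).
  elim: k => [_|k IH km].
    rewrite big_ord0 mulr0 subr0 (@eqE _ _ _ _ (fun w => V w * _) V)// => w.
    by rewrite /A/= mulr1.
  have {IH} := IH (ltnW km).
  have -> : E (fun w => V w * A k.+1 w) =
      E (fun w => V w * A k w) - a k * E (fun w => V w * z k w * B k w).
    have iVA : intg P (fun w => V w * A k w) by exact: intgM_bdd.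
    have iVzB : intg P (fun w => V w * z k w * B k w) by exact: intgM_bdd.
    rewrite -EZ// -EB//; last exact: intgZ.
    by apply: eqE => w; rewrite /A /B/=; ring.
  have [_ h] : `|E (fun w => V w * z k w * A k w)| <= e k /\
               `|E (fun w => V w * z k w * B k w)| <= e k.
    by apply: test => // [|u /fPk[]//]; exact: ltnW.
  have : a k * E (fun w => V w * z k w * B k w) <= e k.
    apply: (le_trans (ler_norm _)); rewrite normrM -[leRHS]mul1r.
    by apply: ler_pM => //; exact: an.
  have := e_le k; rewrite big_ord_recr/=; lra.
have EV := cov_limit_lower lowL tailM.
have etaB := eta_le.
pose S k w := \sum_(i < k) a i * X (f i) w.
have iS k : intg P (S k).
  by apply: (intg_sum (f := fun i w => a i * X (f i) w)) => i _; exact: intgZ.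
have iXz i k : intg P (fun w => X (f i) w * z k w) by exact: intgM_bdd.
(* The slope [1 / 16 + 1 / 64] stays below [1 / 8 - 1 / 32] minus the [eta] errors. Its surplus
   [1 / 64] later pays for the remaining error, at most [6 * eta]. *)
have ESB k : (k <= m)%N ->
    (1 / 16 + 1 / 64) * (\sum_(i < k) a i ^+ 2) - 3 * (eta * \sum_(i < k) (2^-1) ^+ i) <=
    E (fun w => S k w * B k w).
  elim: k => [_|k IH km].
    rewrite !big_ord0 !mulr0 subr0 (@eqE _ _ _ _ _ (fun=> 0)) ?E_cst// => w.
    by rewrite /S big_ord0 mul0r.
  have {IH} := IH (ltnW km); have km' := ltnW km.
  have iSB : intg P (fun w => S k w * B k w) by exact: intgM_bdd.
  have iSz : intg P (fun w => S k w * z k w) by exact: intgM_bdd.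
  have iSzA : intg P (fun w => S k w * z k w * A k w) by exact: intgM_bdd.
  have iXB : intg P (fun w => X (f k) w * B k w) by exact: intgM_bdd.
  have iXzA : intg P (fun w => X (f k) w * z k w * A k w) by exact: intgM_bdd.
  (* In [(S k + a k X) * (B k + a k z A k)] the two terms linear in [a k] are small by the choice of
     [f k]; the quadratic one carries the main contribution. *)
  have -> : E (fun w => S k.+1 w * B k.+1 w) = E (fun w => S k w * B k w) +
      a k * E (fun w => S k w * z k w * A k w) + a k * E (fun w => X (f k) w * B k w) +
      a k ^+ 2 * E (fun w => X (f k) w * z k w * A k w).
    have j1 := intgZ (a k) iSzA; have j2 := intgZ (a k) iXB.
    have j3 := intgZ (a k ^+ 2) iXzA.
    rewrite -EZ// -EZ// -EZ// -ED// -ED//; last exact: intgD.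
    rewrite -ED//; last by apply: intgD => //; exact: intgD.
    by apply: eqE => w; rewrite {1}/S big_ord_recr/= -/(S k w) /B /A/=; ring.
  have ak : `|a k| <= 1 by exact: an.
  have t1 : - (eta * (2^-1) ^+ k) <= a k * E (fun w => S k w * z k w * A k w).
    have iXzAi i : intg P (fun w => X (f i) w * z k w * A k w) by exact: intgM_bdd.
    have SzA : `|E (fun w => S k w * z k w * A k w)| <= k%:R * e k.
      rewrite (@eqE _ _ _ _ _ (fun w => \sum_(i < k) a i * (X (f i) w * z k w * A k w))).
        rewrite (E_sum (f := fun i w => a i * (X (f i) w * z k w * A k w))); last first.
          by move=> i _; exact: intgZ.
        apply: (le_trans (ler_norm_sum _ _ _)).
        apply: (@le_trans _ _ (\sum_(i < k) e k)).
          apply: ler_sum => i _; rewrite EZ// normrM -[leRHS]mul1r; apply: ler_pM => //.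
            by apply: an; exact: ltn_trans km.
          have [//|u uk|//] := test k (fun w => X (f i) w * z k w) km'.
          by have [_ h _ _] := fPk _ _ uk; exact: h.
        by rewrite sumr_const card_ord mulr_natl.
      by move=> w; rewrite /S !mulr_suml; apply: eq_bigr => i _; ring.
    rewrite lerNl -mulrN; apply: (le_trans (ler_norm _)); rewrite normrM normrN.
    apply: le_trans (ke_le k); rewrite -[leRHS]mul1r.
    by apply: ler_pM.
  have t2 : - (eta * (2^-1) ^+ k) <= a k * E (fun w => X (f k) w * B k w).
    have [_ XB] : `|E (fun w => X (f k) w * A k w)| <= e k /\
                  `|E (fun w => X (f k) w * B k w)| <= e k.
      by apply: test => // u /fPk[].
    rewrite lerNl -mulrN; apply: (le_trans (ler_norm _)); rewrite normrM normrN.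
    apply: le_trans (e_le k); rewrite -[leRHS]mul1r.
    by apply: ler_pM.
  (* [X] is replaced by its truncation at level [M], at a cost of [1 / 32] by [tailM'], and then the
     product with [z k] by its limit [V], at a cost of [e k]. *)
  have t3 : E (fun w => X (f k) w * z k w * A k w) >= E (fun w => V w * A k w) -
      eta * (2^-1) ^+ k - 32^-1.
    have icz : intg P (fun w => clamp M (X (f k) w) * z k w - V w).
      by apply: intg_bdd => //; apply: bddB => //; exact: bddM.
    have [czA _] : `|E (fun w => (clamp M (X (f k) w) * z k w - V w) * A k w)| <= e k /\
                  `|E (fun w => (clamp M (X (f k) w) * z k w - V w) * B k w)| <= e k.
      by apply: test => // u /fPk[].
    have iT := intgX_clamp p1 mX normX (f k) (ltW M0).
    have izA : bdd (fun w => z k w * A k w) by exact: bddM.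
    have iTzA : intg P (fun w => (X (f k) w - clamp M (X (f k) w)) * (z k w * A k w)).
      exact: intgM_bdd.
    have iczA : intg P (fun w => (clamp M (X (f k) w) * z k w - V w) * A k w).
      exact: intgM_bdd.
    have iVA : intg P (fun w => V w * A k w) by exact: intgM_bdd.
    have -> : E (fun w => X (f k) w * z k w * A k w) =
       E (fun w => (X (f k) w - clamp M (X (f k) w)) * (z k w * A k w)) +
       E (fun w => (clamp M (X (f k) w) * z k w - V w) * A k w) + E (fun w => V w * A k w).
      rewrite -ED// -ED//; last exact: intgD.
      by apply: eqE => w; ring.
    have TzA : `|E (fun w => (X (f k) w - clamp M (X (f k) w)) * (z k w * A k w))| <= 32^-1.
      apply: (le_trans (norm_E iTzA)).
      apply: (@le_trans _ _ (E (fun w => (2 * L * CB) * `|X (f k) w - clamp M (X (f k) w)|))).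
        apply: le_E => [||w]; [exact: intg_norm|by apply: intgZ; exact: intg_norm|].
        rewrite normrM mulrC; apply: ler_wpM2r => //; rewrite normrM.
        by apply: ler_pM => //; case: (AB_le k w km').
      rewrite EZ; last exact: intg_norm.
      apply: (@le_trans _ _ (2 * L * CB * (64 * L * CB)^-1)).
        by apply: ler_wpM2l => //; rewrite !mulr_ge0// ltW.
      rewrite le_eqVlt; apply/orP; left; apply/eqP; field.
      by rewrite !gt_eqF.
    have := e_le k; move: czA TzA; rewrite !ler_norml => /andP[? _] /andP[? _]; lra.
  have EVAk := EVA k km'; have sk := ler_wpM2l (ltW eta0) (sum_half_pow R k).
  have h0 : 0 <= (2^-1 : R) ^+ k by rewrite exprn_ge0// invr_ge0.
  have a20 := sqr_ge0 (a k).
  have a21 : a k ^+ 2 <= 1 by rewrite -(real_normK (num_real (a k))) expr_le1.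
  have t4 : a k ^+ 2 * (1 / 16 + 1 / 64) - eta * (2^-1) ^+ k <=
      a k ^+ 2 * E (fun w => X (f k) w * z k w * A k w).
    have : a k ^+ 2 * (1 / 16 + 1 / 64 - eta * (2^-1) ^+ k) <=
        a k ^+ 2 * E (fun w => X (f k) w * z k w * A k w).
      by apply: ler_wpM2l => //; lra.
    by have : a k ^+ 2 * (eta * (2^-1) ^+ k) <= eta * (2^-1) ^+ k;
      [rewrite -[leRHS]mul1r ler_wpM2r// mulr_ge0 ?(ltW eta0)|lra].
  by rewrite !big_ord_recr/=; lra.
have {ESB} := ESB m (leqnn m); rewrite am => ESB.
have sm := ler_wpM2l (ltW eta0) (sum_half_pow R m).
have iSB : intg P (fun w => S m w * B m w) by exact: intgM_bdd.
have : E (fun w => S m w * B m w) <= CB * E (fun w => `|S m w|).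
  apply: (le_trans (ler_norm _)); apply: (le_trans (norm_E iSB)).
  rewrite -EZ; last exact: intg_norm.
  apply: le_E => [||w]; [exact: intg_norm|by apply: intgZ; exact: intg_norm|].
  by rewrite normrM mulrC ler_wpM2r//; case: (AB_le m w (leqnn m)).
move=> h; have {}h : 1 / 16 <= CB * E (fun w => `|S m w|) by lra.
by rewrite invfM ler_pdivrMr// [leRHS]mulrC -[leLHS]mul1r.
Qed.

End Levels.

End LowerEstimate.

(** * Passage to norms *)

Section LnormPower.
Context d (T : measurableType d) (R : realType) (P : probability T R) (p : R).
Local Notation E := (Rintegral P setT).
Hypothesis p0 : 0 < p.

Lemma Lnorm_EFin (f : T -> R) : intg P (fun w => `|f w| `^ p) ->
  Lnorm P p%:E (EFin \o f) = ((E (fun w => `|f w| `^ p)) `^ p^-1)%:E.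
Proof.
by move=> ip; rewrite unlock -poweR_EFin EFin_E//; congr (_ `^ _)%E. Qed.

Lemma Lnorm_le_powR (f : T -> R) (c : R) : measurable_fun setT f ->
  (Lnorm P p%:E (EFin \o f) <= c%:E)%E ->
  intg P (fun w => `|f w| `^ p) /\ E (fun w => `|f w| `^ p) <= c `^ p.
Proof.
move=> mf fc.
have c0 : 0 <= c by rewrite -lee_fin; apply: le_trans fc; exact: Lnorm_ge0.
have h : (\int[P]_w (`|f w| `^ p)%:E <= (c `^ p)%:E)%E.
  have -> : (\int[P]_w (`|f w| `^ p)%:E = Lnorm P p%:E (EFin \o f) `^ p)%E.
    by rewrite poweR_Lnorm ?gt_eqF.
  rewrite -poweR_EFin; apply: gt0_ler_poweR; rewrite ?(ltW p0) ?in_itv/= ?Lnorm_ge0 ?lee_fin ?leey ?andbT ?c0//.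
have ip : intg P (fun w => `|f w| `^ p).
  apply/integrableP; split; first by apply/measurable_EFinP; exact: measurable_norm_powR.
  under eq_integral do rewrite /= ger0_norm ?powR_ge0//.
  by apply: (le_lt_trans h); rewrite ltry.
by split=> //; rewrite -lee_fin EFin_E.
Qed.

End LnormPower.

(** * The two implications for the norm *)

Section Equivalence.
Context d (T : measurableType d) (R : realType) (P : probability T R).
Context (mu : R.-pker T ~> R) (X : nat -> T -> R) (p : R).
Local Notation E := (Rintegral P setT).
Hypothesis p1 : 1 <= p.
Hypothesis p2 : p < 2.
Hypothesis mX : forall n, measurable_fun setT (X n).
Hypothesis detX : determining P X.
Hypothesis limX : limit_random_measure P X mu.
Hypothesis normX : forall n, Lnorm P p%:E (EFin \o X n) = 1%E.
Hypothesis uiX : uniformly_integrable P (fun n w => `|X n w| `^ p).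
Hypothesis wX : weakly_to_zero P p X.

Let p0 : 0 < p := lt_le_trans ltr01 p1.

Lemma l2_subsequence_necessary : has_l2_subsequence P p X ->
  (\int[P]_w ((\int[mu w]_x (x ^+ 2)%:E) `^ (p / 2)) < +oo)%E.
Proof.
move=> [nk [nkS [K [K0 H]]]].
apply: (E_second_moment_powR p1 p2 mX detX limX nkS (K := K `^ p)) => m a.
have [_ /(Lnorm_le_powR p0)[|h1 h2]] := H m (fun i => a i).
  apply: (@measurable_sum _ _ _ setT _ _ (fun (i : 'I_m) w => a i * X (nk i) w)) => i.
  exact: measurable_funM.
split=> //; apply: (le_trans h2); rewrite (powRM _ (ltW K0) (sqrtr_ge0 _)).
apply: ler_wpM2l; first exact: powR_ge0.
rewrite -powR12_sqrt; last by rewrite sumr_ge0// => i _; exact: sqr_ge0.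
by rewrite -powRrM mulrC.
Qed.

(** The level in [well_spread] changes with each term, while [L] and [M] stay fixed. Only the index
    is shared, and every condition on it holds eventually. *)
Lemma near_good_extension (L M eta : R) : 0 < L -> L <= M -> 0 < eta ->
  (\int[P]_w ((\int[mu w]_x (x ^+ 2)%:E) `^ (p / 2)) < +oo)%E ->
  forall s : seq (nat * R), exists y : nat * R, [/\ well_spread P mu X p s y,
    riesz_test P mu X L M eta [seq z.1 | z <- s] y.1 &
    forall z, z \in s -> (z.1 < y.1)%N].
Proof.
move=> L0 LM eta0 intm s.
have [N hN] := near_well_spread p1 p2 mX detX limX normX uiX wX intm s.
have h2 := near_riesz_test p1 mX detX limX normX wX L0 LM eta0 [seq z.1 | z <- s].
have h3 : \forall n \near \oo, forall z, z \in s -> (z.1 < n)%N.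
  by apply: near_in_seq => z _; exact: nbhs_infty_gt.
have : \forall n \near \oo, [/\ well_spread P mu X p s (n, N),
    riesz_test P mu X L M eta [seq z.1 | z <- s] n &
    forall z, z \in s -> (z.1 < n)%N].
  by near=> n; split; near: n.
by case=> n _ /(_ n (leqnn n)) h; exists (n, N).
Unshelve. all: by end_near. Qed.

Lemma normalized_l2_subsequence :
  (\int[P]_w ((\int[mu w]_x (x ^+ 2)%:E) `^ (p / 2)) < +oo)%E ->
  exists nk : nat -> nat, (forall k, (nk k < nk k.+1)%N) /\
  exists c C : R, [/\ 0 < c, 0 < C & forall m (a : nat -> R),
    \sum_(i < m) a i ^+ 2 = 1 ->
    [/\ intg P (fun w => `|\sum_(i < m) a i * X (nk i) w| `^ p),
        c <= E (fun w => `|\sum_(i < m) a i * X (nk i) w| `^ p) &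
        E (fun w => `|\sum_(i < m) a i * X (nk i) w| `^ p) <= C]].
Proof.
move=> intm.
have [L L1 lowL] := clamp_sqr_lower p1 p2 mX normX uiX.
have L0 : 0 < L by exact: lt_le_trans L1.
set CB := expR ((2 * L) ^+ 2).
have CB0 : 0 < CB by exact: expR_gt0.
pose e := Num.min (64 * L)^-1 (64 * L * CB)^-1.
have e0 : 0 < e by rewrite lt_min !invr_gt0 !mulr_gt0.
have [M0 _ tail] := clamp_tail p1 mX normX uiX e0.
pose M := Num.max M0 L.
have LM : L <= M by rewrite le_max lexx orbT.
have M0M : M0 <= M by rewrite le_max lexx.
have tail1 n : E (fun w => `|X n w - clamp M (X n w)|) <= (64 * L)^-1.
  by have [_ /le_trans] := tail M n M0M; apply; rewrite ge_min lexx.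
have tail2 n : E (fun w => `|X n w - clamp M (X n w)|) <= (64 * L * CB)^-1.
  by have [_ /le_trans] := tail M n M0M; apply; rewrite ge_min lexx orbT.
have [eta eta0 eta1] : exists2 eta : R, 0 < eta & 512 * eta <= 1 by exists (1 / 512); lra.
have [f fQ] := sequential_choice (near_good_extension L0 LM eta0 intm).
pose nk k := (f k).1.
have mapf k : [seq z.1 | z <- mkseq f k] = mkseq nk k by rewrite /mkseq -map_comp.
have [C C0 upper] := upper_estimate p1 p2 mX normX
  (mu := mu) intm (fun k => let: And3 h _ _ := fQ k in h).
have rt k : riesz_test P mu X L M eta (mkseq nk k) (nk k).
  by have [_ + _] := fQ k; rewrite mapf.
have lower := lower_estimate p1 mX detX limX normX wX L0 LM eta0 eta1 lowL tail1 tail2 rt.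
exists nk; split.
  by move=> k; have [_ _] := fQ k.+1; apply; apply/mapP; exists k; rewrite // mem_iota/=.
(* Half of the lower bound [1 / (16 * CB)] for the first absolute moment, so that [norm_le_powR] at
   threshold [h] leaves [h ^ (p - 1) * (2 * h - h)]. *)
pose h := (32 * CB)^-1.
have h0 : 0 < h by rewrite invr_gt0 mulr_gt0.
exists (h `^ (p - 1) * h), C; split => [||m a a1]; [by rewrite mulr_gt0// powR_gt0|by []|].
have [|ip Ep] := upper m a; first by rewrite a1.
split=> //.
have iS : intg P (fun w => \sum_(i < m) a i * X (nk i) w).
  apply: (intg_sum (f := fun i w => a i * X (nk i) w)) => i _.
  exact: intgZ _ (intgX p1 mX normX _).
have P1 : P setT = 1%E := probability_setT P.
have iSn := intg_norm iS.
apply: (@le_trans _ _ (E (fun w => h `^ (p - 1) * (`|\sum_(i < m) a i * X (nk i) w| - h)))).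
  rewrite EZ; last by apply: intgB => //; exact: intg_cst.
  rewrite EB//; last exact: intg_cst.
  rewrite E_cst//; apply: ler_wpM2l; first exact: powR_ge0.
  have := lower m a a1; rewrite -/CB.
  have -> : (16 * CB)^-1 = 2 * h by rewrite /h; field; rewrite gt_eqF.
  by lra.
have ih : intg P (fun w => `|\sum_(i < m) a i * X (nk i) w| - h).
  by apply: intgB => //; exact: intg_cst.
apply: le_E => [||w]; [exact: intgZ|exact: ip|exact: norm_le_powR].
Qed.

(** By homogeneity it is enough to treat coefficients of unit length; the zero vector, which cannot
    be normalized, is handled apart. *)
Lemma l2_subsequence_sufficient :
  (\int[P]_w ((\int[mu w]_x (x ^+ 2)%:E) `^ (p / 2)) < +oo)%E ->
  has_l2_subsequence P p X.
Proof.
move=> /normalized_l2_subsequence[nk [nkS [c [C [c0 C0 H]]]]].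
exists nk; split=> //.
have pV0 : 0 <= p^-1 by rewrite invr_ge0 ltW.
have cp0 : 0 < c `^ p^-1 by exact: powR_gt0.
have Cp0 : 0 < C `^ p^-1 by exact: powR_gt0.
pose K := C `^ p^-1 + (c `^ p^-1)^-1.
have K0 : 0 < K by rewrite addr_gt0// invr_gt0.
exists K; split=> // m a.
set l := Num.sqrt _.
have s0 : 0 <= \sum_(i < m) a i ^+ 2 by rewrite sumr_ge0// => i _; exact: sqr_ge0.
have [l0|ln0] := eqVneq l 0.
  have a0 i : a i = 0.
    have sE : \sum_(i < m) a i ^+ 2 = 0.
      by apply/eqP; rewrite eq_le s0 andbT -sqrtr_eq0; apply/eqP.
    apply/eqP; rewrite -sqrf_eq0; apply/eqP.
    have /psumr_eq0P := sE; apply => // j _; exact: sqr_ge0.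
  have -> : (fun w => (\sum_(i < m) a i * X (nk i) w)%:E) = cst 0%E.
    by apply/funext => w; rewrite big1// => i _; rewrite a0 mul0r.
  by rewrite Lnorm0 ?eqe ?gt_eqF// l0 !mulr0.
have lp : 0 < l by rewrite lt_neqAle eq_sym ln0 sqrtr_ge0.
have l2 : l ^+ 2 = \sum_(i < m) a i ^+ 2 by rewrite sqr_sqrtr.
(* The normalized coefficients, extended by 0 from ['I_m] to all natural numbers. *)
pose b j := if insub j is Some i then a i / l else 0.
have bE (i : 'I_m) : b i = a i / l by rewrite /b valK.
have b1 : \sum_(i < m) b i ^+ 2 = 1.
  under eq_bigr do rewrite bE expr_div_n.
  by rewrite -mulr_suml -l2 divff// expf_neq0.
have [ib cb bC] := H m b b1.
set Eb := E _ in cb bC.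
have sumE w : \sum_(i < m) a i * X (nk i) w = l * \sum_(i < m) b i * X (nk i) w.
  rewrite mulr_sumr; apply: eq_bigr => i _.
  by rewrite bE mulrA [l * _]mulrC divfK.
have normE w : `|\sum_(i < m) a i * X (nk i) w| `^ p =
    l `^ p * `|\sum_(i < m) b i * X (nk i) w| `^ p.
  by rewrite sumE normrM (gtr0_norm lp) powRM// ltW.
have ia : intg P (fun w => `|\sum_(i < m) a i * X (nk i) w| `^ p).
  by under [X in intg _ X]eq_fun do rewrite normE; exact: intgZ.
have -> : Lnorm P p%:E (fun w => (\sum_(i < m) a i * X (nk i) w)%:E) =
    (l * Eb `^ p^-1)%:E.
  rewrite (@Lnorm_EFin _ _ _ _ _ (fun w => \sum_(i < m) a i * X (nk i) w))//.
  congr (_%:E); under [X in Rintegral _ _ X]eq_fun do rewrite normE.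
  rewrite EZ// powRM ?powR_ge0//; last exact: le_trans (ltW c0) cb.
  by rewrite -powRrM mulfV ?gt_eqF// powRr1// ltW.
have Eb0 : 0 <= Eb by exact: le_trans (ltW c0) cb.
rewrite !lee_fin; split.
  rewrite mulrC ler_wpM2l ?(ltW lp)//; apply: (@le_trans _ _ (c `^ p^-1)).
    rewrite -[leRHS]invrK lef_pV2 ?posrE ?invr_gt0//.
    by rewrite /K lerDr ltW.
  by apply: ge0_ler_powR; rewrite ?nnegrE ?(ltW c0).
rewrite mulrC ler_wpM2r ?(ltW lp)//; apply: (@le_trans _ _ (C `^ p^-1)).
  by apply: ge0_ler_powR; rewrite ?nnegrE ?(ltW C0).
by rewrite /K lerDl invr_ge0 ltW.
Qed.

End Equivalence.

Unset Implicit Arguments.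

Theorem theorem1 (d : measure_display) (T : measurableType d) (R : realType)
  (P : probability T R) (p : R) (X : nat -> T -> R) (mu : R.-pker T ~> R) :
  1 <= p -> p < 2 ->
  (forall n, measurable_fun setT (X n)) ->
  determining P X ->
  (forall n, Lnorm P p%:E (EFin \o X n) = 1%E) ->
  uniformly_integrable P (fun n w => `|X n w| `^ p) ->
  weakly_to_zero P p X ->
  limit_random_measure P X mu ->
  (has_l2_subsequence P p X <->
   (\int[P]_w ((\int[mu w]_x (x ^+ 2)%:E) `^ (p / 2)) < +oo)%E).
Proof.
move=> p1 p2 mX detX normX uiX wX limX; split.
- exact: l2_subsequence_necessary p1 p2 mX detX limX.
- exact: l2_subsequence_sufficient p1 p2 mX detX limX normX uiX wX.
Qed.
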